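(* (a) Let $m,n$ be integers satisfying $0\leq m\leq 2n$. Then \[ \int_\Delta\frac{f^nh^m}{g^{2m+1}}\,dx\,dy = 2^{-2n-3}\, \frac{\Gamma(n+\frac12)^2} {\Gamma(2n-m+\frac12)\,\Gamma(m+\frac12)} \int_{[0,1]^2} \frac{x^{m-\frac12}y^m(1-x)^n(1-y)^{n-\frac12}} {(1-xy)^{m+1}}\,dx\,dy. \] (b) Let $m,n$ be integers satisfying $0\leq m\leq 2n+1$. Then \[ \int_\Delta\frac{f^nh^m}{g^{2m}}\,dx\,dy =2^{-2n-3}\, \frac{\Gamma(n+\frac12)\,\Gamma(n+\frac32)} {\Gamma(2n-m+\frac32)\,\Gamma(m+\frac12)} \int_{[0,1]^2} \frac{x^{m-\frac12}y^m(1-x)^n(1-y)^{n-\frac12}} {(1-xy)^m}\,dx\,dy. \]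
   Context: Here $\Delta=\{(x,y)\in\mathbb{R}^2 : x\ge 0,\ y\ge 0,\ 1-x-y\geq 0\}$, and \[ f=x^2y^2,\qquad g=1-x^2-y^2,\qquad h=\prod_{\delta,\delta'\in\{\pm1\}}(1-\delta x-\delta' y). \] $\Gamma$ is the Gamma function. *)

(* Defs.v *)
From HB Require Import structures.
From mathcomp Require Import all_boot all_order all_algebra.
From mathcomp Require Import all_classical all_reals all_analysis.

Set Implicit Arguments.
Unset Strict Implicit.
Unset Printing Implicit Defensive.
Import Order.TTheory GRing.Theory Num.Theory.
Import numFieldNormedType.Exports.

Local Open Scope classical_set_scope.
Local Open Scope ring_scope.

(* Euler's integral; it converges, and so is the Gamma function, for 0 < s.
   For s <= 0 the value is not meaningful. *)
Definition Gamma (R : realType) (s : R) : R :=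
  \int[@lebesgue_measure R]_(t in `]0, +oo[) (t `^ (s - 1) * expR (- t)).

Definition lebesgue_plane (R : realType) :
    {measure set (measurableTypeR R * measurableTypeR R) -> \bar R} :=
  (@lebesgue_measure R \x @lebesgue_measure R)%E.

Definition Delta (R : realType) : set (R * R) :=
  [set p | [/\ 0 <= p.1, 0 <= p.2 & 0 <= 1 - p.1 - p.2]].

Definition unit_square (R : realType) : set (R * R) := `[0, 1] `*` `[0, 1].

Definition f (R : realType) (p : R * R) : R := p.1 ^+ 2 * p.2 ^+ 2.

Definition g (R : realType) (p : R * R) : R := 1 - p.1 ^+ 2 - p.2 ^+ 2.

Definition h (R : realType) (p : R * R) : R :=
  \prod_(d <- [:: 1; -1]) \prod_(d' <- [:: 1; -1]) (1 - d * p.1 - d' * p.2).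

Definition triangle_integrand (R : realType) (m n k : nat) (p : R * R) : R :=
  f p ^+ n * h p ^+ m / g p ^+ k.

Definition square_integrand (R : realType) (m n k : nat) (p : R * R) : R :=
  p.1 `^ (m%:R - 2^-1) * p.2 ^+ m * (1 - p.1) ^+ n * (1 - p.2) `^ (n%:R - 2^-1)
  / (1 - p.1 * p.2) ^+ k.

(* Main.v *)
Require Import Defs.
From HB Require Import structures.
From mathcomp Require Import all_boot all_order all_algebra.
From mathcomp Require Import all_classical all_reals all_analysis.
From mathcomp Require Import measurable_realfun ring lra.

(** Both identities are chains of exact substitutions between integrals of
    nonnegative functions; the parameter e is 0 in part (a) and 1 in part (b),
    and the exponent of g is k with k + e = 2 m + 1.

    On the triangle put s = 2 x y / g. Then 4 f = s^2 g^2, and since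
    h = g^2 - 4 f we also have h = (1 - s^2) g^2, so that the integrand becomes
    4^-n s^(2n) (1 - s^2)^m times a power of g. The coordinates (y / x, s) run
    over the whole strip ]0, oo[ x ]0, 1[ (integral_triangle_polar). On a curve
    of constant s, the integral over tau = y / x is a quadratic transformation
    of Gauss's hypergeometric function; it is carried out by a substitution in
    which g = p q, where t = p^2 and q^2 = (1 - t) / (1 - w t), w = 1 - s^2. The
    pulled back measure is a sum of two halves exchanged by the involution
    p <-> q, so either half may be kept (integral_slope_moment). Thus the
    triangle integral is 2^-(2n+3) times an Euler integral
      E(a, b, c, d, k) = int x^a (1 - x)^b y^c (1 - y)^d (1 - x y)^k dx dy
    over the unit square (integral_triangle_euler).

    These Euler integrals, which are values at 1 of 3F2 functions, have two
    symmetries. The substitution y = (1 - v) / (1 - x v) gives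
    euler_integral_mobius, which costs no constant. The symmetry of the inner
    2F1 in its two numerator parameters gives euler_integral_swap_numerators,
    which costs a quotient of two beta functions. Applying the first, the
    second and the first again turns the triangle integral into the integral
    over the square. By Gamma(a) Gamma(b) = Gamma(a + b) B(a, b) the quotient of
    beta functions is the stated quotient of Gamma values, because the two
    pairs of arguments have the same sum 2 n + 1 + e.

    Everything is proved for extended-real integrals of nonnegative functions.
    Convergence is then read off one member of the chain, which is bounded by
    B(1/2, 1/2)^2 (euler_integral_fin), and it propagates along the equalities. *)

Import Order.TTheory GRing.Theory Num.Theory.
Import numFieldNormedType.Exports.
Local Open Scope classical_set_scope.
Local Open Scope ring_scope.

Local Notation I01 := (`]0%R, 1%R[%classic).

(** * Change of variables between open intervals *)

Section substitution.
Context {R : realType}.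
Notation mu := (@lebesgue_measure R).
Implicit Types (I J : set R) (F f G : R -> R) (u v : nat -> R).

Lemma integral_exhaustion I u v (H : R -> \bar R) :
  {homo u : m n / (m <= n)%N >-> n <= m} -> {homo v : m n / (m <= n)%N >-> m <= n} ->
  \bigcup_n `[u n, v n]%classic = I -> measurable_fun I H ->
  (forall x, I x -> (0 <= H x)%E) ->
  (\int[mu]_(x in `[u n, v n]) H x)%E @[n --> \oo] --> (\int[mu]_(x in I) H x)%E.
Proof.
move=> du iv UI mH H0; rewrite -UI.
have sub n : `[u n, v n]%classic `<=` I by rewrite -UI => x xn; exists n.
apply: ge0_nondecreasing_set_cvg_integral => //.
- move=> m n mn; rewrite subsetEset => x /=; rewrite !in_itv/= => /andP[ux xv].
  by rewrite (le_trans (du _ _ mn))//= (le_trans xv)// iv.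
- move=> n; apply: measurable_funS mH => //.
  by rewrite -UI; apply: bigcup_measurable => k _; exact: measurable_itv.
- by move=> n x /sub; exact: H0.
Qed.

Section common.
Variables (I J : set R) (F f G : R -> R) (u v : nat -> R).
Hypothesis oI : open I.
Hypothesis du : {homo u : m n / (m <= n)%N >-> n <= m}.
Hypothesis iv : {homo v : m n / (m <= n)%N >-> m <= n}.
Hypothesis uv : forall n, u n <= v n.
Hypothesis UI : \bigcup_n `[u n, v n]%classic = I.
Hypothesis FIJ : forall x, I x -> J (F x).
Hypothesis dF : forall x, I x -> is_derive x 1 F (f x).
Hypothesis cf : forall x, I x -> {for x, continuous f}.
Hypothesis cG : forall y, J y -> {for y, continuous G}.
Hypothesis G0 : forall y, J y -> 0 <= G y.
Hypothesis surj : forall y, J y -> exists a b, [/\ I a, I b, F a <= y & y <= F b].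

Let Iuv n x : `[u n, v n]%classic x -> I x.
Proof. by move=> xn; rewrite -UI; exists n. Qed.

Let Iu n : I (u n).
Proof. by apply: (Iuv n); rewrite /= in_itv/= lexx uv. Qed.

Let Iv n : I (v n).
Proof. by apply: (Iuv n); rewrite /= in_itv/= lexx uv. Qed.

Let dFE x : I x -> derive1 F x = f x.
Proof. by move=> Ix; rewrite derive1E; have [] := dF x Ix. Qed.

Let cdF x : I x -> {for x, continuous (derive1 F)}.
Proof.
move=> Ix; have cfx := cf x Ix; rewrite /prop_for /continuous_at dFE//.
apply: cvg_trans cfx; apply: near_eq_cvg; near=> z; rewrite dFE//.
near: z; exact: open_nbhs_nbhs (conj oI Ix).
Unshelve. all: by end_near. Qed.

Let cFI x : I x -> {for x, continuous F}.
Proof.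
move=> Ix; have [d _] := dF x Ix.
exact/differentiable_continuous/derivable1_diffP.
Qed.

Let derF n : derivable_oo_LRcontinuous F (u n) (v n).
Proof.
split.
- move=> x xuv; have [|//] := dF x.
  by apply: (Iuv n); exact: subset_itv_oo_cc xuv.
- by apply: cvg_at_right_filter; exact: cFI.
- by apply: cvg_at_left_filter; exact: cFI.
Qed.

Let mGF : measurable_fun I (G \o F).
Proof.
apply: open_continuous_measurable_fun => // x; rewrite inE => Ix.
by apply: continuous_comp; [exact: cFI|exact/cG/FIJ].
Qed.

Let mGk (k : R -> R) : (forall x, I x -> {for x, continuous k}) ->
  measurable_fun I (EFin \o (fun x => G (F x) * k x)).
Proof.
move=> ck; apply/measurable_EFinP; apply: measurable_funM => //.
by apply: open_continuous_measurable_fun => // x /[!inE]; exact: ck.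
Qed.

(** Both sides are limits of integrals over compact intervals, where the
    substitution rule for functions continuous up to the endpoints applies. *)
Let subst_limit (c d : nat -> R) (k : R -> R) :
  {homo c : m n / (m <= n)%N >-> n <= m} -> {homo d : m n / (m <= n)%N >-> m <= n} ->
  \bigcup_n `[c n, d n]%classic = J ->
  (forall x, I x -> {for x, continuous k}) -> (forall x, I x -> 0 <= k x) ->
  (forall n, {within `[c n, d n], continuous G} ->
    \int[mu]_(y in `[c n, d n]) (G y)%:E =
    \int[mu]_(x in `[u n, v n]) (G (F x) * k x)%:E)%E ->
  (\int[mu]_(y in J) (G y)%:E = \int[mu]_(x in I) (G (F x) * k x)%:E)%E.
Proof.
move=> dc id UJ ck k0 eqn.
have cGn n : {within `[c n, d n], continuous G}.
  apply: continuous_in_subspaceT => y /[!inE] yn.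
  by apply: cG; rewrite -UJ; exists n.
have mG : measurable_fun J (EFin \o G).
  apply/measurable_EFinP; rewrite -UJ; apply/measurable_fun_bigcup => n.
    exact: measurable_itv.
  by apply: subspace_continuous_measurable_fun => //; exact: measurable_itv.
have L := @integral_exhaustion J c d (EFin \o G) dc id UJ mG
  (fun y Jy => eqbRL (lee_fin _ _) (G0 y Jy)).
have K : (\int[mu]_(x in `[u n, v n]) (G (F x) * k x)%:E)%E @[n --> \oo]
    --> (\int[mu]_(x in I) (G (F x) * k x)%:E)%E.
  apply: integral_exhaustion => //; first exact: mGk.
  by move=> x Ix; rewrite lee_fin mulr_ge0 ?k0// G0//; exact: FIJ.
apply: (@cvg_unique _ (@ereal_hausdorff R)) L _.
by apply: cvg_trans K; apply: near_eq_cvg; near=> n => /=; rewrite eqn.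
Unshelve. all: by end_near. Qed.

Let cover y : J y -> exists i j n, [/\ `[u n, v n]%classic i,
  `[u n, v n]%classic j, F i <= y & y <= F j].
Proof.
move=> Jy; have [i [j [Ii Ij iy yj]]] := surj y Jy.
move: (Ii) (Ij); rewrite -{1 2}UI => -[p _ /= pi] [q _ /= qj].
exists i, j, (maxn p q); split => //; move: pi qj; rewrite /= !in_itv/=.
  move=> /andP[ui iv'] _; rewrite (le_trans _ ui) ?du ?leq_maxl//=.
  by rewrite (le_trans iv')// iv// leq_maxl.
move=> _ /andP[uj jv]; rewrite (le_trans _ uj) ?du ?leq_maxr//=.
by rewrite (le_trans jv)// iv// leq_maxr.
Qed.

Let image n y : Num.min (F (u n)) (F (v n)) <= y <= Num.max (F (u n)) (F (v n)) ->
  J y.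
Proof.
move=> yn; have cFn : {within `[u n, v n], continuous F}.
  exact: derivable_oo_LRcontinuous_within.
by have [c cn <-] := IVT (uv n) cFn yn; exact/FIJ/(Iuv n).
Qed.

Lemma subst_incr : {in I &, {homo F : x y / x < y}} ->
  (forall x, I x -> 0 <= f x) ->
  (\int[mu]_(y in J) (G y)%:E = \int[mu]_(x in I) (G (F x) * f x)%:E)%E.
Proof.
move=> incF f0.
have nF x y : I x -> I y -> x <= y -> F x <= F y.
  move=> Ix Iy; rewrite le_eqVlt => /predU1P[->//|xy].
  by apply/ltW/incF; rewrite ?inE.
have Fuv n : F (u n) <= F (v n) by exact: nF.
apply: (subst_limit (F \o u) (F \o v)) => //=.
- by move=> m n mn; apply: nF => //; exact: du.
- by move=> m n mn; apply: nF => //; exact: iv.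
- apply/seteqP; split=> [y [n _]/=|y /cover[i [j [n [ni nj iy yj]]]]].
    rewrite in_itv/= => yn; apply: (image n).
    by rewrite (min_idPl (Fuv n)) (max_idPr (Fuv n)).
  have Ii := Iuv n i ni; have Ij := Iuv n j nj.
  move: ni nj; rewrite /= !in_itv/= => /andP[ui _] /andP[_ jv].
  exists n => //=; rewrite in_itv/= (le_trans _ iy) ?nF//=.
  by rewrite (le_trans yj)// nF.
- move=> n cGn; rewrite integration_by_substitution_increasing//.
  + apply: eq_integral => x /[!inE] xn /=; rewrite !fctE dFE//; exact: Iuv xn.
  + by move=> x y xn yn; apply: incF; apply/mem_set; exact: (Iuv n).
  + by move=> x xn; apply: cdF; apply: (Iuv n); exact: subset_itv_oo_cc xn.
  + apply/cvg_ex; exists (derive1 F (u n)); apply: cvg_at_right_filter; exact: cdF.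
  + apply/cvg_ex; exists (derive1 F (v n)); apply: cvg_at_left_filter; exact: cdF.
Qed.

Lemma subst_decr : {in I &, {homo F : x y /~ x < y}} ->
  (forall x, I x -> f x <= 0) ->
  (\int[mu]_(y in J) (G y)%:E = \int[mu]_(x in I) (G (F x) * - f x)%:E)%E.
Proof.
move=> decF f0.
have nF x y : I x -> I y -> x <= y -> F y <= F x.
  move=> Ix Iy; rewrite le_eqVlt => /predU1P[->//|xy].
  by apply/ltW/decF; rewrite ?inE.
have Fvu n : F (v n) <= F (u n) by exact: nF.
apply: (subst_limit (F \o v) (F \o u)) => //=.
- by move=> m n mn; apply: nF => //; exact: iv.
- by move=> m n mn; apply: nF => //; exact: du.
- apply/seteqP; split=> [y [n _]/=|y /cover[i [j [n [ni nj iy yj]]]]].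
    rewrite in_itv/= => yn; apply: (image n).
    by rewrite (min_idPr (Fvu n)) (max_idPl (Fvu n)).
  have Ii := Iuv n i ni; have Ij := Iuv n j nj.
  move: ni nj; rewrite /= !in_itv/= => /andP[_ iv'] /andP[uj _].
  exists n => //=; rewrite in_itv/= (le_trans _ iy) ?nF//=.
  by rewrite (le_trans yj)// nF.
- by move=> x Ix; apply: continuousN; exact: cf.
- by move=> x Ix; rewrite oppr_ge0 f0.
- move=> n cGn; rewrite integration_by_substitution_decreasing//.
  + by apply: eq_integral => x /[!inE] xn /=; rewrite !fctE dFE//; exact: Iuv xn.
  + by move=> x y xn yn; apply: decF; apply/mem_set; exact: (Iuv n).
  + by move=> x xn; apply: cdF; apply: (Iuv n); exact: subset_itv_oo_cc xn.
  + apply/cvg_ex; exists (derive1 F (u n)); apply: cvg_at_right_filter; exact: cdF.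
  + apply/cvg_ex; exists (derive1 F (v n)); apply: cvg_at_left_filter; exact: cdF.
Qed.

End common.

(** Open interval, in the form in which it is used: the endpoints, where the
    integrands may blow up and which may be infinite, are only approached. *)
Definition compactly_exhausted I := open I /\ exists u v,
  [/\ {homo u : m n / (m <= n)%N >-> n <= m}, {homo v : m n / (m <= n)%N >-> m <= n},
     forall n, u n <= v n & \bigcup_n `[u n, v n]%classic = I].

Lemma compactly_exhausted_itv0b b : 0 < b -> compactly_exhausted `]0, b[%classic.
Proof.
move=> b0; split; first exact: interval_open.
have le_inv m n : (m <= n)%N -> b / n.+2%:R <= b / m.+2%:R.
  by move=> mn; rewrite ler_pM2l// lef_pV2 ?posrE// ler_nat.
exists (fun n => b / n.+2%:R), (fun n => b - b / n.+2%:R); split.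
- exact: le_inv.
- by move=> m n mn; rewrite lerD2l lerN2 le_inv.
- move=> n; have : b / n.+2%:R <= b / 2 by exact: (le_inv 0%N).
  by move: (b / n.+2%:R) => r; lra.
- apply/seteqP; split=> [x [n _]|x]; rewrite /= !in_itv/=.
    have : 0 < b / n.+2%:R by exact: divr_gt0.
    by move: (b / n.+2%:R) => r ? /andP[? ?]; apply/andP; split; lra.
  move=> /andP[x0 xb]; pose r := Num.min x (b - x).
  have r0 : 0 < r by rewrite /r lt_min x0 subr_gt0.
  have [n nr] : exists n, b / n.+2%:R <= r.
    exists (Num.truncn (b / r)); rewrite ler_pdivrMr// mulrC -ler_pdivrMr//.
    by rewrite (le_trans (ltW (Num.Theory.truncnS_gt _)))// ler_nat.
  exists n => //; rewrite /= in_itv/=; move: nr.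
  by rewrite /r le_min; move: (b / _) => c /andP[? ?]; apply/andP; split; lra.
Qed.

Lemma compactly_exhausted_itv0y : compactly_exhausted `]0, +oo[%classic.
Proof.
split; first exact: interval_open.
exists (fun n => n.+1%:R^-1), (fun n => n.+1%:R); split.
- by move=> m n mn; rewrite lef_pV2 ?posrE// ler_nat.
- by move=> m n mn; rewrite ler_nat.
- by move=> n; rewrite (@le_trans _ _ 1) ?ler1n// invf_le1// ler1n.
- apply/seteqP; split=> [x [n _]|x]; rewrite /= !in_itv/= andbT.
    by move=> /andP[nx _]; rewrite (lt_le_trans _ nx).
  move=> x0; exists (maxn (Num.truncn x) (Num.truncn x^-1)) => //=; rewrite in_itv/=.
  apply/andP; split.
    rewrite -[leRHS]invrK lef_pV2 ?posrE ?invr_gt0//.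
    by rewrite (le_trans (ltW (Num.Theory.truncnS_gt _)))// ler_nat ltnS leq_maxr.
  by rewrite (le_trans (ltW (Num.Theory.truncnS_gt _)))// ler_nat ltnS leq_maxl.
Qed.

(** Continuity is asked on the open sets I and J alone, so singularities of beta
    type at the endpoints are allowed. That J is covered by F is asked in the
    form from which the intermediate value theorem gives surjectivity. *)
Lemma ge0_substitution_increasing I J F f G : compactly_exhausted I ->
  (forall x, I x -> J (F x)) ->
  (forall x, I x -> is_derive x 1 F (f x)) ->
  (forall x, I x -> {for x, continuous f}) ->
  (forall y, J y -> {for y, continuous G}) ->
  (forall y, J y -> 0 <= G y) ->
  (forall y, J y -> exists a b, [/\ I a, I b, F a <= y & y <= F b]) ->
  {in I &, {homo F : x y / x < y}} -> (forall x, I x -> 0 <= f x) ->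
  (\int[mu]_(y in J) (G y)%:E = \int[mu]_(x in I) (G (F x) * f x)%:E)%E.
Proof.
move=> [oI [u [v [du iv uv UI]]]] FIJ dF cf cG G0 surj.
exact: (@subst_incr I J F f G u v).
Qed.

Lemma ge0_substitution_decreasing I J F f G : compactly_exhausted I ->
  (forall x, I x -> J (F x)) ->
  (forall x, I x -> is_derive x 1 F (f x)) ->
  (forall x, I x -> {for x, continuous f}) ->
  (forall y, J y -> {for y, continuous G}) ->
  (forall y, J y -> 0 <= G y) ->
  (forall y, J y -> exists a b, [/\ I a, I b, F a <= y & y <= F b]) ->
  {in I &, {homo F : x y /~ x < y}} -> (forall x, I x -> f x <= 0) ->
  (\int[mu]_(y in J) (G y)%:E = \int[mu]_(x in I) (G (F x) * - f x)%:E)%E.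
Proof.
move=> [oI [u [v [du iv uv UI]]]] FIJ dF cf cG G0 surj.
exact: (@subst_decr I J F f G u v).
Qed.

End substitution.

(** * Tonelli's theorem in the plane *)

Section tonelli.
Context {R : realType}.
Notation mu := (@lebesgue_measure R).
Local Open Scope ereal_scope.
Implicit Types (S : set (R * R)) (A B : set R) (H : R * R -> \bar R).

Lemma tonelli_plane S H : measurable S -> measurable_fun setT H ->
  (forall p, S p -> 0 <= H p) ->
  \int[lebesgue_plane R]_(p in S) H p =
    \int[mu]_x \int[mu]_(y in [set y | S (x, y)]) H (x, y) /\
  \int[lebesgue_plane R]_(p in S) H p =
    \int[mu]_y \int[mu]_(x in [set x | S (x, y)]) H (x, y).
Proof.
move=> mS mH H0; rewrite /lebesgue_plane integral_mkcond.
have mHS : measurable_fun setT (H \_ S).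
  by apply/(measurable_restrictT H mS); exact: measurable_funS mH.
have HS0 p : 0 <= (H \_ S) p by exact: erestrict_ge0.
split.
- etransitivity; first exact: (fubini_tonelli1 (m1 := mu) (m2 := mu) _ mHS HS0). apply: eq_integral => x _.
  rewrite /fubini_F [RHS]integral_mkcond; apply: eq_integral => y _.
  by rewrite !patchE; congr (if _ then _ else _); apply/idP/idP; rewrite !inE.
- etransitivity; first exact: (fubini_tonelli2 (m1 := mu) (m2 := mu) _ mHS HS0). apply: eq_integral => y _.
  rewrite /fubini_G [RHS]integral_mkcond; apply: eq_integral => x _.
  by rewrite !patchE; congr (if _ then _ else _); apply/idP/idP; rewrite !inE.
Qed.


Lemma measurable_integral_section S H : measurable S -> measurable_fun setT H ->
  (forall p, S p -> 0 <= H p) ->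
  measurable_fun setT (fun x => \int[mu]_(y in [set y | S (x, y)]) H (x, y)).
Proof.
move=> mS mH H0.
have -> : (fun x => \int[mu]_(y in [set y | S (x, y)]) H (x, y)) = fubini_F mu (H \_ S).
  apply/funext => x; rewrite /fubini_F [LHS]integral_mkcond; apply: eq_integral => y _.
  by rewrite !patchE; congr (if _ then _ else _); apply/idP/idP; rewrite !inE.
apply: measurable_fun_fubini_tonelli_F.
  by apply/(measurable_restrictT H mS); exact: measurable_funS mH.
by move=> p; exact: erestrict_ge0.
Qed.

Lemma tonelli_rectangle A B H : measurable A -> measurable B ->
  measurable_fun setT H -> (forall x y, A x -> B y -> 0 <= H (x, y)) ->
  \int[lebesgue_plane R]_(p in A `*` B) H p =
    \int[mu]_(x in A) \int[mu]_(y in B) H (x, y) /\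
  \int[mu]_(x in A) \int[mu]_(y in B) H (x, y) =
    \int[mu]_(y in B) \int[mu]_(x in A) H (x, y).
Proof.
move=> mA mB mH H0.
have mAB : measurable (A `*` B) by exact: measurableX.
have HAB p : (A `*` B) p -> 0 <= H p.
  by case: p => x y [Ax By]; exact: H0.
have [E1 E2] := @tonelli_plane (A `*` B) H mAB mH HAB.
have {}E1 : \int[lebesgue_plane R]_(p in A `*` B) H p =
    \int[mu]_(x in A) \int[mu]_(y in B) H (x, y).
  rewrite E1 [RHS]integral_mkcond; apply: eq_integral => x _.
  rewrite patchE; case: ifPn => [|/negP]; rewrite inE => Ax.
    by congr (integral _ _ _); apply/seteqP; split=> y /= => [[]|].
  rewrite (_ : [set y | _] = set0) ?integral_set0//.
  by apply/seteqP; split=> y //= -[].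
split; first exact: E1.
rewrite -E1 E2 [RHS]integral_mkcond; apply: eq_integral => y _.
rewrite patchE; case: ifPn => [|/negP]; rewrite inE => By.
  by congr (integral _ _ _); apply/seteqP; split=> x /= => [[]|].
rewrite (_ : [set x | _] = set0) ?integral_set0//.
by apply/seteqP; split=> x //= -[].
Qed.

Lemma measurable_integral_snd B H : measurable B -> measurable_fun setT H ->
  (forall x y, B y -> 0 <= H (x, y)) ->
  measurable_fun setT (fun x => \int[mu]_(y in B) H (x, y)).
Proof.
move=> mB mH H0.
have mS : measurable ([set: R] `*` B) by apply: measurableX.
have SH p : ([set: R] `*` B) p -> 0 <= H p by case: p => x y [_ By]; exact: H0.
have := measurable_integral_section _ _ mS mH SH; congr (measurable_fun _ _).
apply/funext => x; congr (integral _ _ _).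
by apply/seteqP; split=> y /= => [[]|].
Qed.

End tonelli.

(** * Real powers *)

Section powers.
Context {R : realType}.
Implicit Types (x a : R).

Lemma powR_expR x a : 0 < x -> x `^ a = expR (a * ln x).
Proof. by move=> x0; rewrite /powR gt_eqF. Qed.

Lemma is_derive_continuous (u : R -> R) x d :
  is_derive x 1 u d -> {for x, continuous u}.
Proof. by move=> [ud _]; exact/differentiable_continuous/derivable1_diffP. Qed.

Lemma continuous_powR_comp (u : R -> R) a x :
  {for x, continuous u} -> 0 < u x -> {for x, continuous (fun y => u y `^ a)}.
Proof.
move=> cu u0; apply: (@continuous_comp _ _ _ u (@powR R ^~ a)) => //.
exact: is_derive_continuous (is_derive1_powR a u0).
Qed.

(** x^-1 = x (x^2)^-1, where the last factor is a power of a nonnegative base. *)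
Lemma measurable_inv : measurable_fun [set: R] (@GRing.inv R).
Proof.
have -> : @GRing.inv R = (fun x => x * (x ^+ 2) `^ (-1)).
  apply/funext => x; rewrite powR_inv1 ?sqr_ge0//.
  have [->|x0] := eqVneq x 0; first by rewrite invr0 mul0r.
  by field.
apply: measurable_funM => //; apply: (measurableT_comp (measurable_powR _)).
exact: measurable_funX.
Qed.

End powers.

(** * The Moebius involution of the unit interval *)


Section mobius.
Context {R : realType}.
Notation mu := (@lebesgue_measure R).
Implicit Types (x y v : R).

(** Substituting y = mobius x v in Euler's integral for 2F1(x) is Euler's
    transformation: y, 1 - y and 1 - x y become monomials in v, 1 - v, 1 - x
    and 1 - x v. *)
Definition mobius x v : R := (1 - v) / (1 - x * v).

Lemma mobius_denom_gt0 x v : 0 <= x < 1 -> 0 < v < 1 -> 0 < 1 - x * v.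
Proof. by move=> *; nra. Qed.

Lemma mobius01 x v : 0 <= x < 1 -> 0 < v < 1 -> 0 < mobius x v < 1.
Proof.
move=> x01 v01; have d0 := mobius_denom_gt0 x v x01 v01.
apply/andP; split; first by apply: divr_gt0 => //; lra.
by rewrite ltr_pdivrMr// mul1r; nra.
Qed.

Lemma onem_mobius x v : 0 < 1 - x * v -> 1 - mobius x v = (1 - x) * v / (1 - x * v).
Proof. by move=> d0; rewrite /mobius; field; rewrite gt_eqF. Qed.

Lemma onemM_mobius x v : 0 < 1 - x * v -> 1 - x * mobius x v = (1 - x) / (1 - x * v).
Proof. by move=> d0; rewrite /mobius; field; rewrite gt_eqF. Qed.

Lemma mobiusK x v : 0 <= x < 1 -> 0 < v < 1 -> mobius x (mobius x v) = v.
Proof.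
move=> x01 v01; have d0 := mobius_denom_gt0 x v x01 v01.
rewrite {1}/mobius onem_mobius// onemM_mobius//; field.
by rewrite !gt_eqF//; lra.
Qed.

Lemma mobius_decr x v v' : 0 <= x < 1 -> 0 < v < 1 -> 0 < v' < 1 -> v < v' ->
  mobius x v' < mobius x v.
Proof.
move=> x01 v01 v01' vv'; have := mobius_denom_gt0 x v x01 v01.
have := mobius_denom_gt0 x v' x01 v01' => dv' dv.
by rewrite /mobius ltr_pdivrMr// mulrAC ltr_pdivlMr//; nra.
Qed.

Lemma is_derive_mobius x v : 0 < 1 - x * v ->
  is_derive v 1 (mobius x) (- ((1 - x) / (1 - x * v) ^+ 2)).
Proof.
move=> d0; apply: is_derive_eq.
  apply: is_deriveM; apply: is_deriveV; by rewrite gt_eqF.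
rewrite /GRing.scale/= /cst; field; by rewrite gt_eqF.
Qed.

Lemma integral_mobius x (G : R -> R) : 0 <= x < 1 ->
  (forall y, I01 y -> {for y, continuous G}) ->
  (forall y, I01 y -> 0 <= G y) ->
  (\int[mu]_(y in I01) (G y)%:E =
   \int[mu]_(v in I01) (G (mobius x v) * ((1 - x) / (1 - x * v) ^+ 2))%:E)%E.
Proof.
move=> x01 cG G0.
have d0 v : I01 v -> 0 < 1 - x * v.
  by rewrite /= in_itv/=; exact: mobius_denom_gt0.
have FIJ v : I01 v -> I01 (mobius x v).
  by rewrite /= !in_itv/=; exact: mobius01.
transitivity (\int[mu]_(v in I01)
    (G (mobius x v) * - - ((1 - x) / (1 - x * v) ^+ 2))%:E)%E; last first.
  by apply: eq_integral => v _; rewrite opprK.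
apply: ge0_substitution_decreasing => //.
- exact: compactly_exhausted_itv0b.
- by move=> v /d0; exact: is_derive_mobius.
- move=> v /d0 d0v; apply: continuousN; apply: continuousM; first exact: cst_continuous.
  apply: continuousV; first by rewrite expf_neq0// gt_eqF.
  exact: (is_derive_continuous (fun v => (1 - x * v) ^+ 2)).
- move=> y y01; exists (mobius x y), (mobius x y).
  by split; try exact: FIJ; rewrite mobiusK//; move: y01; rewrite /= in_itv.
- move=> v v' /[!inE]/=; rewrite !in_itv/= => v01 v01'.
  exact: mobius_decr.
- move=> v /d0 dv; rewrite oppr_le0 divr_ge0 ?sqr_ge0//; lra.
Qed.

End mobius.

(** * Euler integrals over the unit square *)

Section euler.
Context {R : realType}.
Notation mu := (@lebesgue_measure R).
Implicit Types (a b c d k x y : R).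

Definition euler_kernel a b c d k (p : R * R) : R :=
  p.1 `^ a * (1 - p.1) `^ b * p.2 `^ c * (1 - p.2) `^ d * (1 - p.1 * p.2) `^ k.

(** Up to the factor B(a + 1, b + 1) B(c + 1, d + 1), this is the value at 1 of
    the 3F2 function with numerator parameters - k, a + 1, c + 1 and denominator
    parameters a + b + 2, c + d + 2. *)
Definition euler_integral a b c d k : \bar R :=
  (\int[mu]_(x in I01) \int[mu]_(y in I01) (euler_kernel a b c d k (x, y))%:E)%E.

Definition beta_integral a b : \bar R :=
  (\int[mu]_(y in I01) (y `^ (a - 1) * (1 - y) `^ (b - 1))%:E)%E.

Lemma euler_kernel_ge0 a b c d k p : 0 <= euler_kernel a b c d k p.
Proof. by rewrite /euler_kernel !mulr_ge0 ?powR_ge0. Qed.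

Lemma measurable_euler_kernel a b c d k :
  measurable_fun setT (euler_kernel a b c d k).
Proof.
have mpow (u : R * R -> R) e :
    measurable_fun setT u -> measurable_fun setT (fun p => u p `^ e).
  by move=> mu'; exact: (measurableT_comp (measurable_powR _)).
rewrite /euler_kernel; do 4?apply: measurable_funM; apply: mpow => //.
- exact: measurable_funB.
- exact: measurable_funB.
- by apply: measurable_funB => //; exact: measurable_funM.
Qed.

Lemma euler_integral_swap a b c d k :
  euler_integral a b c d k = euler_integral c d a b k.
Proof.
have mE : measurable_fun setT (EFin \o euler_kernel a b c d k).
  by apply/measurable_EFinP; exact: measurable_euler_kernel.
have [_ E] := @tonelli_rectangle R I01 I01 (EFin \o euler_kernel a b c d k)
  (measurable_itv _) (measurable_itv _) mE
  (fun x y _ _ => euler_kernel_ge0 _ _ _ _ _ _).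
rewrite /euler_integral [LHS]E; apply: eq_integral => y _.
apply: eq_integral => x _; congr EFin; rewrite /euler_kernel/= [y * x]mulrC; ring.
Qed.

(** Euler's transformation of the inner 2F1, by the substitution
    y = mobius x v. *)
Lemma euler_integral_mobius a b c d k :
  euler_integral a b c d k = euler_integral a (b + d + k + 1) d c (- (c + d + k + 2)).
Proof.
apply: eq_integral => x /[!inE]/=; rewrite in_itv/= => x01.
rewrite (integral_mobius x (fun y => euler_kernel a b c d k (x, y))).
- apply: eq_integral => v /[!inE]/=; rewrite in_itv/= => v01; congr EFin.
  have x01' : 0 <= x < 1 by lra.
  have d0 := mobius_denom_gt0 x v x01' v01.
  rewrite /euler_kernel/= onem_mobius// onemM_mobius// /mobius.
  have [x0 x1 v0 v1] : [/\ 0 < x, 0 < 1 - x, 0 < v & 0 < 1 - v] by split; lra.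
  have {1}-> : (1 - x) / (1 - x * v) ^+ 2 = expR (ln (1 - x) - 2 * ln (1 - x * v)).
    by rewrite expRD lnK// expRN mulrC expRM_natl lnK// mulrC.
  rewrite !powR_expR ?divr_gt0 ?mulr_gt0// !ln_div ?posrE ?mulr_gt0// lnM ?posrE//.
  rewrite -!expRD; congr expR; ring.
- by lra.
- move=> y /=; rewrite in_itv/= => y01.
  rewrite /euler_kernel/=.
  do 4?apply: continuousM; try exact: cst_continuous.
  + by apply: (continuous_powR_comp id); [exact: is_derive_continuous|lra].
  + by apply: (continuous_powR_comp (fun y => 1 - y)); [exact: is_derive_continuous|lra].
  + by apply: (continuous_powR_comp (fun y => 1 - x * y)); [exact: is_derive_continuous|nra].
- by move=> y _; exact: euler_kernel_ge0.
Qed.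

Let mpow (u : R * R -> R) e :
  measurable_fun setT u -> measurable_fun setT (fun p => u p `^ e).
Proof. by move=> mu'; exact: (measurableT_comp (measurable_powR _)). Qed.

Let measurable_slice a b k z : measurable_fun (I01 : set R)
  (fun x : R => (x `^ a * (1 - x) `^ b * (1 - z * x) `^ k)%:E).
Proof.
apply/measurable_EFinP/measurable_funTS; apply: measurable_funM.
  apply: measurable_funM; first exact: measurable_powR.
  by apply: (measurableT_comp (measurable_powR _)); exact: measurable_funB.
apply: (measurableT_comp (measurable_powR _)); exact: measurable_funB.
Qed.

(** The exponent - (a + b) is the one for which the powers of 1 - x v cancel
    after the substitution y = mobius x v. Read from left to right, it trades
    the power - a of 1 - x for the power - (a + b) of 1 - x y, which depends on
    a through a + b only. *)
Lemma beta_integral_onemM a b x : 0 <= x < 1 ->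
  (beta_integral b a * ((1 - x) `^ (- a))%:E =
   \int[mu]_(y in I01)
     (y `^ (a - 1) * (1 - y) `^ (b - 1) * (1 - x * y) `^ (- (a + b)))%:E)%E.
Proof.
move=> x01.
have mb : measurable_fun (I01 : set R) (fun y : R => (y `^ (b - 1) * (1 - y) `^ (a - 1))%:E).
  apply/measurable_EFinP/measurable_funTS; apply: measurable_funM.
    exact: measurable_powR.
  by apply: (measurableT_comp (measurable_powR _)); exact: measurable_funB.
rewrite /beta_integral -ge0_integralZr; last 4 first.
- exact: measurable_itv.
- exact: mb.
- by move=> y _; rewrite lee_fin mulr_ge0 ?powR_ge0.
- by rewrite lee_fin powR_ge0.
rewrite (integral_mobius x
  (fun y => y `^ (a - 1) * (1 - y) `^ (b - 1) * (1 - x * y) `^ (- (a + b)))) //.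
- apply: eq_integral => v /[!inE]/=; rewrite in_itv/= => v01; congr EFin.
  have d0 := mobius_denom_gt0 x v x01 v01.
  rewrite onem_mobius// onemM_mobius// /mobius.
  have [x1 v0 v1] : [/\ 0 < 1 - x, 0 < v & 0 < 1 - v] by split; lra.
  have -> : (1 - x) / (1 - x * v) ^+ 2 = expR (ln (1 - x) - 2 * ln (1 - x * v)).
    by rewrite expRD lnK// expRN mulrC expRM_natl lnK// mulrC.
  rewrite !powR_expR ?divr_gt0 ?mulr_gt0// !ln_div ?posrE ?mulr_gt0// lnM ?posrE//.
  rewrite -!expRD; congr expR; ring.
- move=> y /=; rewrite in_itv/= => y01.
  do 2?apply: continuousM.
  + by apply: (continuous_powR_comp id); [exact: is_derive_continuous|lra].
  + by apply: (continuous_powR_comp (fun y => 1 - y)); [exact: is_derive_continuous|lra].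
  + by apply: (continuous_powR_comp (fun y => 1 - x * y)); [exact: is_derive_continuous|nra].
- by move=> y _; rewrite !mulr_ge0 ?powR_ge0.
Qed.

(** The three-variable kernel that is symmetric under the exchange of
    (p.1, b, b') with (p.2, a, a') as soon as a + a' = b + b'. *)
Let kernel3 a a' b b' z (p : R * R) := p.1 `^ (b - 1) * (1 - p.1) `^ (b' - 1) *
  (p.2 `^ (a - 1) * (1 - p.2) `^ (a' - 1)) * (1 - z * p.1 * p.2) `^ (- (a + a')).

Let kernel3_ge0 a a' b b' z p : 0 <= kernel3 a a' b b' z p.
Proof. by rewrite /kernel3 !mulr_ge0 ?powR_ge0. Qed.

Let measurable_kernel3 a a' b b' z :
  measurable_fun setT (EFin \o kernel3 a a' b b' z).
Proof.
apply/measurable_EFinP; rewrite /kernel3.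
apply: measurable_funM; first apply: measurable_funM; first apply: measurable_funM.
- exact: mpow.
- by apply: mpow; exact: measurable_funB.
- by apply: measurable_funM; apply: mpow => //; exact: measurable_funB.
- apply: mpow; apply: measurable_funB => //.
  by apply: measurable_funM => //; exact: measurable_funM.
Qed.

Let beta_integral_inner a a' b b' z : 0 < z < 1 ->
  (beta_integral a' a * \int[mu]_(x in I01)
     (x `^ (b - 1) * (1 - x) `^ (b' - 1) * (1 - z * x) `^ (- a))%:E =
   \int[mu]_(x in I01) \int[mu]_(y in I01) (kernel3 a a' b b' z (x, y))%:E)%E.
Proof.
move=> z01; rewrite -ge0_integralZl; last 4 first.
- exact: measurable_itv.
- exact: measurable_slice.
- by move=> x _; rewrite lee_fin !mulr_ge0 ?powR_ge0.
- by apply: integral_ge0 => y _; rewrite lee_fin mulr_ge0 ?powR_ge0.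
apply: eq_integral => x /[!inE]/=; rewrite in_itv/= => x01.
rewrite mulrC EFinM muleA beta_integral_onemM; last by nra.
rewrite -ge0_integralZr; last 4 first.
- exact: measurable_itv.
- exact: measurable_slice.
- by move=> y _; rewrite lee_fin !mulr_ge0 ?powR_ge0.
- by rewrite lee_fin mulr_ge0 ?powR_ge0.
apply: eq_integral => y _; congr EFin; rewrite /kernel3/=; ring.
Qed.

Let beta_integral_euler a a' b b' c d :
  (beta_integral a' a * euler_integral (b - 1) (b' - 1) c d (- a) =
   \int[mu]_(z in I01) ((z `^ c * (1 - z) `^ d)%:E *
     \int[mu]_(x in I01) \int[mu]_(y in I01) (kernel3 a a' b b' z (x, y))%:E))%E.
Proof.
rewrite euler_integral_swap /euler_integral -ge0_integralZl; last 4 first.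
- exact: measurable_itv.
- apply: measurable_funTS.
  apply: (@measurable_integral_snd _ I01 (EFin \o euler_kernel c d (b - 1) (b' - 1) (- a))).
  + exact: measurable_itv.
  + by apply/measurable_EFinP; exact: measurable_euler_kernel.
  + by move=> x y _; exact: euler_kernel_ge0.
- by move=> z _; apply: integral_ge0 => y _; exact: euler_kernel_ge0.
- by apply: integral_ge0 => y _; rewrite lee_fin mulr_ge0 ?powR_ge0.
apply: eq_integral => z /[!inE]/=; rewrite in_itv/= => z01.
rewrite -beta_integral_inner// muleCA; congr (_ * _)%E.
rewrite -ge0_integralZl; last 4 first.
- exact: measurable_itv.
- exact: measurable_slice.
- by move=> x _; rewrite lee_fin !mulr_ge0 ?powR_ge0.
- by rewrite lee_fin mulr_ge0 ?powR_ge0.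
apply: eq_integral => x _; congr EFin; rewrite /euler_kernel/=; ring.
Qed.

(** Symmetry of 2F1(a, b; a + a'; z) in a and b, integrated over z. Expanding the
    power - a of 1 - z x by beta_integral_onemM gives a triple integral of
    kernel3, whose symmetry is exploited by Tonelli's theorem. *)
Lemma euler_integral_swap_numerators a a' b b' c d : a + a' = b + b' ->
  (beta_integral a' a * euler_integral (b - 1) (b' - 1) c d (- a) =
   beta_integral b' b * euler_integral (a - 1) (a' - 1) c d (- b))%E.
Proof.
move=> ab; rewrite !beta_integral_euler; apply: eq_integral => z _.
apply: (congr1 (mule _)).
have [_ E] := @tonelli_rectangle R I01 I01 (EFin \o kernel3 a a' b b' z)
  (measurable_itv _) (measurable_itv _) (measurable_kernel3 _ _ _ _ _)
  (fun x y _ _ => kernel3_ge0 _ _ _ _ _ _).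
apply: (etrans E); apply: eq_integral => y _; apply: eq_integral => x _.
congr EFin; rewrite /kernel3/= -ab [z * x * y]mulrAC; ring.
Qed.

End euler.

(** * Gamma and beta integrals *)

Section gamma.
Context {R : realType}.
Notation mu := (@lebesgue_measure R).
Notation Ioy := (`]0%R, +oo[%classic : set R).
Implicit Types (a b : R).

Lemma integral_pos (D : set R) (f : R -> R) : measurable D -> (0 < mu D)%E ->
  measurable_fun D f -> (forall x, D x -> 0 < f x) ->
  (0 < \int[mu]_(x in D) (f x)%:E)%E.
Proof.
move=> mD D0 mf f0; have If0 : (0 <= \int[mu]_(x in D) (f x)%:E)%E.
  by apply: integral_ge0 => x /f0; rewrite lee_fin => /ltW.
rewrite lt_neqAle If0 andbT; apply/negP => /eqP int0.
have mEf : measurable_fun D (EFin \o f) by exact/measurable_EFinP.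
have [+ _] := ae_eq_integral_abs mu mD mEf.
have -> : (\int[mu]_(x in D) `|(EFin \o f) x| = 0)%E.
  rewrite [RHS]int0; apply: eq_integral => x /[!inE] /f0 fx.
  by rewrite /= gtr0_norm.
move=> /(_ erefl) [N [mN N0 subN]]; move: D0.
rewrite ltNge => /negP; apply; rewrite -N0; apply: le_measure; rewrite ?inE//.
move=> x Dx; apply: subN => /= /(_ Dx) [fx0].
by have := f0 x Dx; rewrite fx0 ltxx.
Qed.

(** Extended-real valued, so that the product formula below can be proved first
    and finiteness deduced from it. *)
Definition gamma_integral a : \bar R :=
  (\int[mu]_(t in Ioy) (t `^ (a - 1) * expR (- t))%:E)%E.

Lemma GammaE a : Gamma a = fine (gamma_integral a).
Proof. by []. Qed.

Let measurable_gamma a :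
  measurable_fun setT (fun t : R => t `^ (a - 1) * expR (- t)).
Proof.
apply: measurable_funM; first exact: measurable_powR.
by apply: measurableT_comp => //; exact: measurable_funN.
Qed.

Let measurable_beta a b :
  measurable_fun setT (fun y : R => y `^ (a - 1) * (1 - y) `^ (b - 1)).
Proof.
apply: measurable_funM; first exact: measurable_powR.
by apply: (measurableT_comp (measurable_powR _)); exact: measurable_funB.
Qed.

Lemma gamma_integral_gt0 a : (0 < gamma_integral a)%E.
Proof.
apply: integral_pos => //; first by rewrite lebesgue_measure_itv/= ltry sube0 ltry.
- exact: measurable_funTS.
- by move=> t /=; rewrite in_itv/= andbT => t0; rewrite mulr_gt0 ?powR_gt0 ?expR_gt0.
Qed.

Lemma beta_integral_gt0 a b : (0 < beta_integral a b)%E.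
Proof.
apply: integral_pos => //; first by rewrite lebesgue_measure_itv/= lte_fin ltr01 sube0.
- exact: measurable_funTS.
- move=> t /=; rewrite in_itv/= => /andP[t0 t1].
  by rewrite mulr_gt0 ?powR_gt0 ?subr_gt0.
Qed.

Lemma integral_scale c (G : R -> R) : 0 < c ->
  (forall y, Ioy y -> {for y, continuous G}) -> (forall y, Ioy y -> 0 <= G y) ->
  (\int[mu]_(y in Ioy) (G y)%:E = \int[mu]_(t in Ioy) (G (c * t) * c)%:E)%E.
Proof.
move=> c0 cG G0.
apply: (@ge0_substitution_increasing R Ioy Ioy ( *%R c) (cst c) G) => //.
- exact: compactly_exhausted_itv0y.
- by move=> x /=; rewrite !in_itv/= !andbT => x0; rewrite mulr_gt0.
- move=> x _; apply: is_derive_eq; rewrite /GRing.scale/=; ring.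
- by move=> x _; exact: cst_continuous.
- move=> y /=; rewrite !in_itv/= !andbT => y0; exists (y / c), (y / c).
  by rewrite /= !in_itv/= !andbT divr_gt0// mulrC divfK ?gt_eqF.
- by move=> x y _ _ xy; rewrite ltr_pM2l.
- by move=> x _; exact: ltW.
Qed.

(** The substitution v = u (1 - y) / y, that is y = u / (u + v). *)
Lemma integral_itv0y_itv01 u (G : R -> R) : 0 < u ->
  (forall y, Ioy y -> {for y, continuous G}) -> (forall y, Ioy y -> 0 <= G y) ->
  (\int[mu]_(v in Ioy) (G v)%:E =
   \int[mu]_(y in I01) (G (u * (y^-1 - 1)) * (u / y ^+ 2))%:E)%E.
Proof.
move=> u0 cG G0.
transitivity (\int[mu]_(y in I01) (G (u * (y^-1 - 1)) * - - (u / y ^+ 2))%:E)%E; last first.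
  by apply: eq_integral => v _; rewrite opprK.
apply: (@ge0_substitution_decreasing R I01 Ioy (fun y => u * (y^-1 - 1))
  (fun y => - (u / y ^+ 2)) G) => //.
- exact: compactly_exhausted_itv0b.
- move=> x /=; rewrite !in_itv/= !andbT => /andP[x0 x1].
  by rewrite mulr_gt0// subr_gt0 invf_gt1.
- move=> x /=; rewrite in_itv/= => /andP[x0 x1].
  have xn0 : x != 0 by rewrite gt_eqF.
  have dV := @is_deriveV R id x 1 1 xn0 (is_derive_id x 1).
  apply: is_derive_eq; rewrite /GRing.scale/=; field; by [].
- move=> x /=; rewrite in_itv/= => /andP[x0 x1].
  apply: continuousN; apply: continuousM; first exact: cst_continuous.
  apply: continuousV; first by rewrite expf_neq0// gt_eqF.
  exact: (is_derive_continuous (fun v => v ^+ 2)).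
- move=> v /=; rewrite !in_itv/= andbT => v0; exists (u / (u + v)), (u / (u + v)).
  have uv0 : 0 < u + v by lra.
  have -> : u * ((u / (u + v))^-1 - 1) = v by field; rewrite !gt_eqF.
  by rewrite /= !in_itv/= divr_gt0// ltr_pdivrMr// mul1r ltrDl v0 lexx.
- move=> x y /[!inE]/=; rewrite !in_itv/= => /andP[x0 _] /andP[y0 _] xy.
  by rewrite ltr_pM2l// ltrD2r ltf_pV2.
- move=> x /=; rewrite in_itv/= => /andP[x0 _].
  by rewrite oppr_le0 divr_ge0 ?sqr_ge0 ?ltW.
Qed.

Let continuous_gamma a t : 0 < t -> {for t, continuous (fun t : R => t `^ (a - 1) * expR (- t))}.
Proof.
move=> t0; apply: continuousM.
  by apply: (continuous_powR_comp id) => //; exact: is_derive_continuous.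
exact: (is_derive_continuous (expR \o -%R)).
Qed.

(** In the double integral over (u, v), the substitution v = u (1 - y) / y makes
    the exponential equal to exp (- u / y); then u = y t separates t from y. *)
Lemma gamma_integralM a b :
  (gamma_integral a * gamma_integral b = gamma_integral (a + b) * beta_integral a b)%E.
Proof.
pose K (p : R * R) := p.1 `^ (a + b - 1) * expR (- (p.1 / p.2)) *
  (p.2 `^ (- b - 1) * (1 - p.2) `^ (b - 1)).
have K0 p : 0 <= K p by rewrite /K !mulr_ge0 ?powR_ge0 ?expR_ge0.
have mK : measurable_fun setT (EFin \o K).
  have mpow (u : R * R -> R) e :
      measurable_fun setT u -> measurable_fun setT (fun p => u p `^ e).
    by move=> mu'; exact: (measurableT_comp (measurable_powR _)).
  apply/measurable_EFinP; rewrite /K; apply: measurable_funM; apply: measurable_funM.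
  - exact: mpow.
  - apply: measurableT_comp => //; apply: measurableT_comp => //.
    by apply: measurable_funM => //; apply: measurableT_comp => //; exact: measurable_inv.
  - exact: mpow.
  - by apply: mpow; exact: measurable_funB.
transitivity (\int[mu]_(u in Ioy) \int[mu]_(y in I01) (K (u, y))%:E)%E.
  rewrite {1}/gamma_integral -ge0_integralZr; last 4 first.
  - exact: measurable_itv.
  - by apply/measurable_EFinP/measurable_funTS; exact: measurable_gamma.
  - by move=> x _; rewrite lee_fin mulr_ge0 ?powR_ge0 ?expR_ge0.
  - exact: ltW (gamma_integral_gt0 b).
  apply: eq_integral => u /[!inE]/=; rewrite in_itv/= andbT => u0.
  rewrite /gamma_integral (integral_itv0y_itv01 u) //; last 2 first.
  - by move=> y /=; rewrite in_itv/= andbT; exact: continuous_gamma.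
  - by move=> y _; rewrite mulr_ge0 ?powR_ge0 ?expR_ge0.
  rewrite -ge0_integralZl; last 4 first.
  - exact: measurable_itv.
  - apply/measurable_EFinP/measurable_funTS; apply: measurable_funM.
      apply: (measurableT_comp (measurable_gamma b)); apply: measurable_funM => //.
      by apply: measurable_funB => //; exact: measurable_inv.
    apply: measurable_funM => //; apply: (measurableT_comp measurable_inv).
    exact: measurable_funX.
  - move=> y /=; rewrite in_itv/= => /andP[y0 y1].
    by rewrite lee_fin !mulr_ge0 ?powR_ge0 ?expR_ge0 ?invr_ge0 ?sqr_ge0 ?(ltW u0).
  - by rewrite lee_fin mulr_ge0 ?powR_ge0 ?expR_ge0.
  apply: eq_integral => y /[!inE]/=; rewrite in_itv/= => /andP[y0 y1].
  rewrite -EFinM; congr EFin; rewrite /K/=.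
  have [y1' y1'' yn0] : [/\ 0 < y^-1 - 1, 0 < 1 - y & y != 0].
    by rewrite !subr_gt0 invf_gt1// gt_eqF.
  have E : y^-1 - 1 = (1 - y) / y by field.
  have -> : u / y ^+ 2 = expR (ln u - 2 * ln y).
    by rewrite expRD lnK// expRN mulrC expRM_natl lnK// mulrC.
  rewrite !powR_expR ?mulr_gt0// lnM ?posrE// E ln_div ?posrE//.
  rewrite -!expRD; congr expR; field; by [].
have [_ E] := @tonelli_rectangle R Ioy I01 (EFin \o K)
  (measurable_itv _) (measurable_itv _) mK (fun x y _ _ => K0 _).
apply: (etrans E) => {E mK}.
rewrite muleC /beta_integral -ge0_integralZr; last 4 first.
- exact: measurable_itv.
- by apply/measurable_EFinP/measurable_funTS; exact: measurable_beta.
- by move=> x _; rewrite lee_fin mulr_ge0 ?powR_ge0.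
- exact: ltW (gamma_integral_gt0 _).
apply: eq_integral => y /[!inE]/=; rewrite in_itv/= => /andP[y0 y1].
have y1'' : 0 < 1 - y by rewrite subr_gt0.
rewrite (integral_scale y (fun u => K (u, y)) y0); last 2 first.
- move=> u /=; rewrite in_itv/= andbT => u0; rewrite /K/=.
  apply: continuousM; last exact: cst_continuous.
  apply: continuousM; last exact: (is_derive_continuous (expR \o (fun u => - (u / y)))).
  by apply: (continuous_powR_comp id) => //; exact: is_derive_continuous.
- by move=> u _; exact: K0.
rewrite /gamma_integral -ge0_integralZl; last 4 first.
- exact: measurable_itv.
- by apply/measurable_EFinP/measurable_funTS; exact: measurable_gamma.
- by move=> x _; rewrite lee_fin mulr_ge0 ?powR_ge0 ?expR_ge0.
- by rewrite lee_fin mulr_ge0 ?powR_ge0.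
apply: eq_integral => t /[!inE]/=; rewrite in_itv/= andbT => t0.
rewrite -EFinM; congr EFin.
rewrite /K/=.
have -> : y * t / y = t by rewrite mulrAC mulfV ?mul1r// gt_eqF.
rewrite -[X in _ * X = _](lnK y0) !powR_expR ?mulr_gt0// lnM ?posrE//.
rewrite -!expRD; congr expR; ring.
Qed.

(** With t = x^2 this is the Gaussian integral. *)
Lemma gamma_integral_half : (gamma_integral 2^-1 < +oo)%E.
Proof.
rewrite /gamma_integral.
rewrite (_ : integral _ _ _ = \int[mu]_(x in Ioy)
   (((x ^+ 2) `^ (2^-1 - 1) * expR (- x ^+ 2)) * (2 * x))%:E)%E; last first.
  apply: (@ge0_substitution_increasing R Ioy Ioy (fun x => x ^+ 2) (fun x => 2 * x)) => //.
  - exact: compactly_exhausted_itv0y.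
  - by move=> x /=; rewrite !in_itv/= !andbT => x0; rewrite exprn_gt0.
  - move=> x _; apply: is_derive_eq; rewrite /GRing.scale/=; ring.
  - by move=> x _; exact: is_derive_continuous.
  - by move=> y /=; rewrite in_itv/= andbT; exact: continuous_gamma.
  - by move=> y _; rewrite mulr_ge0 ?powR_ge0 ?expR_ge0.
  - move=> y /=; rewrite !in_itv/= !andbT => y0; exists (Num.sqrt y), (Num.sqrt y).
    have E : Num.sqrt y ^+ 2 = y by rewrite sqr_sqrtr ?ltW.
    by split; rewrite /= ?in_itv/= ?andbT ?sqrtr_gt0 ?E.
  - move=> x y /[!inE]/=; rewrite !in_itv/= !andbT => x0 y0 xy.
    by rewrite ltrXn2r ?nnegrE ?ltW.
  - by move=> x /=; rewrite in_itv/= andbT => x0; rewrite mulr_ge0// ltW.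
rewrite (_ : integral _ _ _ =
    \int[mu]_(x in Ioy) (2%:E * (gauss_fun x)%:E))%E; last first.
  apply: eq_integral => x /[!inE]/=; rewrite in_itv/= andbT => x0.
  rewrite -EFinM /gauss_fun; congr EFin.
  have E : (x ^+ 2) `^ (2^-1 - 1) * x = 1.
    rewrite -[X in _ * X](lnK x0) powR_expR ?exprn_gt0// lnXn// -expRD -[RHS]expR0.
    by congr expR; field.
  transitivity ((x ^+ 2) `^ (2^-1 - 1) * x * (2 * expR (- x ^+ 2))); first by ring.
  by rewrite E mul1r.
rewrite ge0_integralZl; last 4 first.
- exact: measurable_itv.
- by apply/measurable_EFinP/measurable_funTS; exact: measurable_gauss_fun.
- by move=> x _; rewrite lee_fin gauss_fun_ge0.
- by rewrite lee_fin.
rewrite integral_itv_obnd_cbnd ?integral0y_gauss ?ltry//.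
by apply/measurable_EFinP/measurable_funTS; exact: measurable_gauss_fun.
Qed.

End gamma.

(** * A quadratic transformation *)

Section quadratic.
Context {R : realType}.
Notation mu := (@lebesgue_measure R).
Notation Ioy := (`]0%R, +oo[%classic : set R).
Variable s : R.
Hypothesis s01 : 0 < s < 1.
Implicit Types (t y : R).

Let s0 : 0 < s. Proof. by case/andP: s01. Qed.
Let s1 : s < 1. Proof. by case/andP: s01. Qed.

Let w := 1 - s ^+ 2.

Let w01 : 0 <= w < 1.
Proof. by rewrite /w; move: s0 s1 => ? ?; apply/andP; split; nra. Qed.

Let phi t := Num.sqrt (mobius w t).

(** With p = sqrt t and q = phi t, the point x^2 = (1 - p) (1 + q) / 2,
    y^2 = (1 + p) (1 - q) / 2 moves along the curve 2 x y = s (1 - x^2 - y^2)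
    when t runs over ]0, 1[, and satisfies 1 - x^2 - y^2 = p q; slope t is its
    ratio y / x. *)
Definition slope t := s * Num.sqrt t * phi t / ((1 - Num.sqrt t) * (1 + phi t)).

Let sqrt01 t : 0 < t < 1 -> 0 < Num.sqrt t < 1.
Proof. by move=> /andP[t0 t1]; rewrite sqrtr_gt0 t0 -sqrtr1 ltr_sqrt. Qed.

Let phi01 t : 0 < t < 1 -> 0 < phi t < 1.
Proof. by move=> t01; apply/sqrt01/mobius01. Qed.

(** The involution p <-> q in symmetric form; all the algebra below rests on
    it. *)
Let rel t : 0 < t < 1 ->
  (1 - Num.sqrt t ^+ 2) * (1 - phi t ^+ 2) = (s * Num.sqrt t * phi t) ^+ 2.
Proof.
move=> t01; have d0 := mobius_denom_gt0 w t w01 t01.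
have /andP[m0 _] := mobius01 w t w01 t01; have /andP[t0 _] := t01.
rewrite !exprMn !sqr_sqrtr ?ltW//.
rewrite onem_mobius// /mobius; rewrite /w in d0 *; field; by rewrite gt_eqF.
Qed.

Let phi_mobius t : 0 < t < 1 -> phi (mobius w t) = Num.sqrt t.
Proof. by move=> t01; rewrite /phi mobiusK. Qed.

Lemma slopeE t : 0 < t < 1 ->
  slope t = (1 + Num.sqrt t) * (1 - phi t) / (s * Num.sqrt t * phi t).
Proof.
move=> t01; have := rel t t01; have := sqrt01 t t01; have := phi01 t t01.
rewrite /slope; move: (Num.sqrt t) (phi t) => p v v01 p01 E.
apply/eqP; rewrite eqr_div; last 2 first.
- by rewrite mulf_neq0 ?gt_eqF//; lra.
- by rewrite !mulf_neq0 ?gt_eqF//; lra.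
by apply/eqP; rewrite -expr2 -E; ring.
Qed.

Lemma slope_gt0 t : 0 < t < 1 -> 0 < slope t.
Proof.
move=> t01; have := sqrt01 t t01; have := phi01 t t01 => v01 p01.
have [p0 v0] : 0 < Num.sqrt t /\ 0 < phi t by lra.
by rewrite divr_gt0 ?mulr_gt0//; lra.
Qed.

Let slope_sqr t : 0 < t < 1 ->
  slope t ^+ 2 = (1 + Num.sqrt t) / (1 - Num.sqrt t) * ((1 - phi t) / (1 + phi t)).
Proof.
move=> t01; rewrite expr2 {2}slopeE// /slope.
have := sqrt01 t t01; have := phi01 t t01.
move: (Num.sqrt t) (phi t) => p v v01 p01; field.
by rewrite !gt_eqF//; lra.
Qed.

(** In the square of the slope the variables p and q separate; p increases with t
    while q decreases. *)
Lemma slope_incr : {in I01 &, {homo slope : x y / x < y}}.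
Proof.
move=> x y /[!inE]/=; rewrite !in_itv/= => x01 y01 xy.
rewrite -(@ltr_pXn2r _ 2)// ?nnegrE ?ltW ?slope_gt0// !slope_sqr//.
have := sqrt01 x x01; have := phi01 x x01.
have := sqrt01 y y01; have := phi01 y y01.
have pxy : Num.sqrt x < Num.sqrt y by rewrite ltr_sqrt//; lra.
have vxy : phi y < phi x.
  have [mx _] := andP (mobius01 w x w01 x01).
  by rewrite /phi ltr_sqrt// mobius_decr.
move: pxy vxy; move: (Num.sqrt x) (phi x) (Num.sqrt y) (phi y) => p v p' v'.
move=> pp vv v'01 p'01 v01 p01; apply: ltr_pM.
- by rewrite divr_ge0//; lra.
- by rewrite divr_ge0//; lra.
- rewrite ltr_pdivrMr; last by lra.
  by rewrite mulrAC ltr_pdivlMr; lra.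
- rewrite ltr_pdivrMr; last by lra.
  by rewrite mulrAC ltr_pdivlMr; lra.
Qed.

Let slope_small y : 0 < y -> exists2 t, 0 < t < 1 & slope t <= y.
Proof.
move: s0 s1 => s0' s1' y0; pose r := Num.min 2^-1 (y / 2).
have r0 : 0 < r by rewrite /r lt_min; apply/andP; split; lra.
have [r2 ry] : r <= 2^-1 /\ r <= y / 2 by rewrite /r !ge_min !lexx orbT.
have t01 : 0 < r ^+ 2 < 1 by apply/andP; split; nra.
exists (r ^+ 2) => //; have := phi01 _ t01; rewrite /slope sqrtr_sqr gtr0_norm//.
move: (phi _) => v v01; rewrite ler_pdivrMr; last by nra.
have : s * r * v <= r.
  by rewrite mulrAC ler_piMl//; nra.
have : 2^-1 <= (1 - r) * (1 + v) by nra.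
rewrite -(ler_pM2l y0).
lra.
Qed.

(** The involution inverts the slope, so this is the behaviour at the other
    end. *)
Let slope_large y : 0 < y -> exists2 t, 0 < t < 1 & y <= slope t.
Proof.
move=> y0; have [t t01 ty] := slope_small y^-1 (eqbRL (invr_gt0 _) y0).
have m01 := mobius01 w t w01 t01.
exists (mobius w t) => //; rewrite slopeE// phi_mobius//.
rewrite -[leLHS]invrK -[leRHS]invrK lef_pV2 ?posrE ?invr_gt0//; last first.
  by rewrite -[Num.sqrt t]phi_mobius// -slopeE// slope_gt0.
apply: le_trans ty; rewrite invf_div /slope -/(phi t) le_eqVlt; apply/orP; left.
apply/eqP; congr (_ / _); ring.
Qed.

(** The logarithmic derivative of the slope is (p + q) / (2 t (1 - t)). *)
Definition slope' t := slope t * ((Num.sqrt t + phi t) / (2 * t * (1 - t))).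

Lemma is_derive_slope t : 0 < t < 1 -> is_derive t 1 slope (slope' t).
Proof.
move=> t01; have d0 := mobius_denom_gt0 w t w01 t01.
have m01 := mobius01 w t w01 t01; have p01 := sqrt01 t t01; have v01 := phi01 t t01.
have [t0 m0] : 0 < t /\ 0 < mobius w t by split; lra.
have [tE mE] : Num.sqrt t ^+ 2 = t /\ phi t ^+ 2 = mobius w t.
  by rewrite !sqr_sqrtr ?ltW.
have dp := is_derive1_sqrt t0.
have dphi : is_derive t 1 phi (- ((1 - phi t ^+ 2) * phi t / (2 * t * (1 - t)))).
  apply: is_derive_eq.
    exact: (is_derive1_comp (is_derive1_sqrt m0) (is_derive_mobius w t d0)).
  rewrite -/(phi t) mE onem_mobius//.
  have -> : (1 - t) = phi t ^+ 2 * (1 - w * t).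
    by rewrite mE /mobius divfK// gt_eqF.
  by field; rewrite !gt_eqF//; lra.
have den0 : (1 - Num.sqrt t) * (1 + phi t) != 0 by rewrite gt_eqF//; nra.
have dden : is_derive t 1 (fun t => (1 - Num.sqrt t) * (1 + phi t))
    ((1 - Num.sqrt t) * - ((1 - phi t ^+ 2) * phi t / (2 * t * (1 - t))) -
     (1 + phi t) / (2 * Num.sqrt t)).
  apply: is_derive_eq; rewrite /GRing.scale/=; field.
  by rewrite !gt_eqF//; lra.
have dinv := @is_deriveV R _ t _ 1 den0 dden.
have dnum : is_derive t 1 (fun t => s * Num.sqrt t * phi t)
    (s * (Num.sqrt t * - ((1 - phi t ^+ 2) * phi t / (2 * t * (1 - t))) +
      phi t / (2 * Num.sqrt t))).
  apply: is_derive_eq; rewrite /GRing.scale/=; field.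
  by rewrite !gt_eqF//; lra.
have D : is_derive t 1 slope _ := is_deriveM dnum dinv.
apply: is_derive_eq; rewrite /slope' /slope /GRing.scale/=.
have -> : 2 * t * (1 - t) = 2 * Num.sqrt t ^+ 2 * (1 - Num.sqrt t ^+ 2) by rewrite tE.
move: p01 v01; move: (Num.sqrt t) (phi t) => p v p01 v01; field.
by rewrite !gt_eqF//; nra.
Qed.

Let cphi t : 0 < t < 1 -> {for t, continuous phi}.
Proof.
move=> t01; apply: (@continuous_comp _ _ _ (mobius w) Num.sqrt).
  by apply: is_derive_continuous (is_derive_mobius w t _); exact: mobius_denom_gt0.
exact: sqrt_continuous.
Qed.

Let continuous_slope' t : 0 < t < 1 -> {for t, continuous slope'}.
Proof.
move=> t01; apply: continuousM.
  by apply: is_derive_continuous (is_derive_slope t t01).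
have t0 : t != 0 by rewrite gt_eqF//; case/andP: t01.
have t1 : 1 - t != 0 by rewrite gt_eqF// subr_gt0; case/andP: t01.
apply: continuousM.
  by apply: continuousD; [exact: sqrt_continuous|exact: cphi].
apply: continuousV; first by rewrite !mulf_neq0.
exact: (is_derive_continuous (fun t => 2 * t * (1 - t))).
Qed.

Lemma integral_slope (G : R -> R) :
  (forall y, Ioy y -> {for y, continuous G}) -> (forall y, Ioy y -> 0 <= G y) ->
  (\int[mu]_(y in Ioy) (G y)%:E = \int[mu]_(t in I01) (G (slope t) * slope' t)%:E)%E.
Proof.
move=> cG G0.
apply: (@ge0_substitution_increasing R I01 Ioy slope slope' G) => //.
- exact: compactly_exhausted_itv0b.
- by move=> t /=; rewrite !in_itv/= andbT; exact: slope_gt0.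
- by move=> t /=; rewrite in_itv/=; exact: is_derive_slope.
- move=> y /=; rewrite in_itv/= andbT => y0.
  have [[a a01 ay] [b b01 yb]] := (slope_small y y0, slope_large y y0).
  by exists a, b; rewrite /= !in_itv.
- exact: slope_incr.
- move=> t /=; rewrite in_itv/= => t01; have [p01 v01] := (sqrt01 t t01, phi01 t t01).
  move: p01 v01 (t01) => /andP[p0 _] /andP[v0 _] /andP[t0 t1].
  rewrite /slope' mulr_ge0 ?(ltW (slope_gt0 t t01))// divr_ge0// ?addr_ge0 ?ltW//.
  by rewrite !mulr_gt0// subr_gt0.
Qed.

(** The value 2 tau / (2 tau + s (1 + tau^2)) of g on the curve is p q. *)
Let q_slope t : 0 < t < 1 -> 2 * slope t =
  Num.sqrt t * phi t * (2 * slope t + s * (1 + slope t ^+ 2)).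
Proof.
move=> t01.
have [/andP[p0 p1] /andP[v0 v1]] := (sqrt01 t t01, phi01 t t01).
have A0 : (1 - Num.sqrt t) * (1 + phi t) != 0.
  by rewrite mulf_neq0 ?gt_eqF ?subr_gt0 ?addr_gt0.
have B0 : s * Num.sqrt t * phi t != 0 by rewrite !mulf_neq0 ?gt_eqF.
have A : s * Num.sqrt t * phi t = slope t * ((1 - Num.sqrt t) * (1 + phi t)).
  by rewrite /slope divfK.
have B : s * Num.sqrt t * phi t * slope t = (1 + Num.sqrt t) * (1 - phi t).
  by rewrite slopeE// mulrC divfK.
rewrite (_ : _ * (_ + _) = 2 * Num.sqrt t * phi t * slope t +
  s * Num.sqrt t * phi t + s * Num.sqrt t * phi t * slope t * slope t); last by ring.
rewrite B A; ring.
Qed.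

Variables (n : nat) (e : bool).
Let N := (2 * n + 1 + e)%N.

Let moment t := (Num.sqrt t * phi t) ^+ N / (t * (1 - t)).

Let moment_ge0 t : 0 < t < 1 -> 0 <= moment t.
Proof.
move=> /andP[t0 t1]; rewrite /moment divr_ge0 ?exprn_ge0 ?mulr_ge0 ?sqrtr_ge0 ?ltW//.
by rewrite subr_gt0.
Qed.

Let continuous_moment t : 0 < t < 1 -> {for t, continuous moment}.
Proof.
move=> t01; move: (t01) => /andP[t0 t1]; apply: continuousM.
  apply: (@continuous_comp _ _ _ (fun t => Num.sqrt t * phi t) (fun x : R => x ^+ N)).
    by apply: continuousM; [exact: sqrt_continuous|exact: cphi].
  exact: exprn_continuous.
apply: continuousV; first by rewrite mulf_neq0// gt_eqF// subr_gt0.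
exact: (is_derive_continuous (fun t => t * (1 - t))).
Qed.

(** The involution exchanges p and q, and it preserves p q and the measure
    dt / (t (1 - t)). *)
Let integral_moment_swap :
  (\int[mu]_(t in I01) (moment t * Num.sqrt t)%:E =
   \int[mu]_(t in I01) (moment t * phi t)%:E)%E.
Proof.
rewrite (integral_mobius w (fun t => moment t * Num.sqrt t) w01).
- apply: eq_integral => t /[!inE]/=; rewrite in_itv/= => t01; congr EFin.
  have d0 := mobius_denom_gt0 w t w01 t01; move: (t01) => /andP[t0 t1].
  rewrite /moment phi_mobius// -/(phi t) onem_mobius// [phi t * _]mulrC /mobius.
  have [_ w1] := andP w01.
  move: (phi t) (_ ^+ N) => v q; field.
  by rewrite !gt_eqF // subr_gt0.
- move=> t /=; rewrite in_itv/= => t01.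
  by apply: continuousM; [exact: continuous_moment|exact: sqrt_continuous].
- by move=> t /=; rewrite in_itv/= => t01; rewrite mulr_ge0 ?moment_ge0 ?sqrtr_ge0.
Qed.

(** Of the two equal halves, the one that is kept depends on the parity of N:
    all exponents of 1 - t and 1 - w t are then free of half integers. *)
Let momentE t : 0 < t < 1 -> moment t * (if e then Num.sqrt t else phi t) =
  t `^ (n%:R - 2^-1 + e%:R) * (1 - t) `^ n%:R * (1 - w * t) `^ (- (n%:R + 1)).
Proof.
move=> t01; have d0 := mobius_denom_gt0 w t w01 t01; have [t0 t1] := andP t01.
have t1' : 0 < 1 - t by rewrite subr_gt0.
have sE : Num.sqrt t = expR (2^-1 * ln t) by rewrite -powR12_sqrt ?powR_expR ?ltW.
have vE : phi t = expR (2^-1 * (ln (1 - t) - ln (1 - w * t))).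
  rewrite /phi /mobius -powR12_sqrt ?divr_ge0 ?ltW// powR_expR ?divr_gt0//.
  by rewrite ln_div ?posrE.
rewrite /moment.
have -> : t * (1 - t) = expR (ln t + ln (1 - t)) by rewrite expRD !lnK.
rewrite vE sE -expRN -expRD -expRM_natl -expRD !powR_expR// -!expRD.
rewrite -(fun_if expR) -expRD; congr expR.
by rewrite /N 2!natrD natrM; case: (e) => /=; field.
Qed.

(** Quadratic transformation: under tau = slope t the integrand becomes a multiple
    of moment t * (p + q), and both terms have the same integral. *)
Lemma integral_slope_moment :
  (\int[mu]_(y in Ioy) ((2 * y) ^+ (2 * n + e) / (2 * y + s * (1 + y ^+ 2)) ^+ N)%:E =
   \int[mu]_(t in I01) (2^-1 * (t `^ (n%:R - 2^-1 + e%:R) * (1 - t) `^ n%:R *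
     (1 - w * t) `^ (- (n%:R + 1))))%:E)%E.
Proof.
have D0 y : 0 < y -> 0 < 2 * y + s * (1 + y ^+ 2).
  by move=> y0; rewrite addr_gt0 ?mulr_gt0 ?addr_gt0 ?exprn_gt0.
rewrite (integral_slope (fun y => (2 * y) ^+ (2 * n + e) / (2 * y + s * (1 + y ^+ 2)) ^+ N)).
- have mEmoment : measurable_fun (I01 : set R) moment.
    apply: open_continuous_measurable_fun; first exact: interval_open.
    by move=> t /[!inE]/=; rewrite in_itv/=; exact: continuous_moment.
  have mphi : measurable_fun (I01 : set R) phi.
    apply: open_continuous_measurable_fun; first exact: interval_open.
    by move=> t /[!inE]/=; rewrite in_itv/=; exact: cphi.
  have msqrt : measurable_fun (I01 : set R) (@Num.sqrt R).
    apply: open_continuous_measurable_fun; first exact: interval_open.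
    by move=> t _; exact: sqrt_continuous.
  have mp : measurable_fun (I01 : set R) (EFin \o (fun t => moment t * Num.sqrt t)).
    by apply/measurable_EFinP; exact: measurable_funM.
  have mv : measurable_fun (I01 : set R) (EFin \o (fun t => moment t * phi t)).
    by apply/measurable_EFinP; exact: measurable_funM.
  have p0 t : I01 t -> (0 <= (moment t * Num.sqrt t)%:E)%E.
    by rewrite /= in_itv/= => t01; rewrite lee_fin mulr_ge0 ?moment_ge0 ?sqrtr_ge0.
  have v0 t : I01 t -> (0 <= (moment t * phi t)%:E)%E.
    by rewrite /= in_itv/= => t01; rewrite lee_fin mulr_ge0 ?moment_ge0 ?sqrtr_ge0.
  transitivity (4^-1%:E * (\int[mu]_(t in I01) (moment t * Num.sqrt t)%:E +
      \int[mu]_(t in I01) (moment t * phi t)%:E))%E.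
    rewrite -ge0_integralD; [|exact: measurable_itv|exact: p0|exact: mp|exact: v0|exact: mv].
    rewrite -ge0_integralZl; last 4 first.
    - exact: measurable_itv.
    - by apply: emeasurable_funD; [exact: mp|exact: mv].
    - by move=> t t01; rewrite adde_ge0 ?p0 ?v0.
    - by rewrite lee_fin.
    apply: eq_integral => t /[!inE]/=; rewrite in_itv/= => t01.
    rewrite -EFinD -EFinM; congr EFin.
    have T0 := slope_gt0 t t01; have := D0 _ T0; have := q_slope t t01.
    rewrite /moment /slope' => q0 d0; move: (t01) => /andP[t0 t1].
    have -> : Num.sqrt t * phi t = 2 * slope t / (2 * slope t + s * (1 + slope t ^+ 2)).
      by rewrite [X in X / _]q0 mulfK// gt_eqF.
    move: T0 d0 {q0}; move: (slope t) => T T0; move: (2 * T + _) => D d0.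
    rewrite (_ : N = (2 * n + e).+1); last by rewrite /N addnAC addn1.
    rewrite expr_div_n !exprSr; have := exprn_gt0 (2 * n + e) d0.
    move: (D ^+ _) ((2 * T) ^+ _) => Dk Tk Dk0.
    by field; rewrite !gt_eqF ?subr_gt0.
  have -> : (\int[mu]_(t in I01) (moment t * Num.sqrt t)%:E +
      \int[mu]_(t in I01) (moment t * phi t)%:E =
      2%:E * \int[mu]_(t in I01) (moment t * if e then Num.sqrt t else phi t)%:E)%E.
    by rewrite mule_natl mule2n; case: (e); rewrite integral_moment_swap.
  rewrite muleA -EFinM (_ : 4^-1 * 2 = 2^-1 :> R); last by field.
  rewrite -ge0_integralZl; last 4 first.
  - exact: measurable_itv.
  - by case: (e); [exact: mp|exact: mv].
  - by move=> t t01; case: (e); [exact: p0|exact: v0].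
  - by rewrite lee_fin.
  apply: eq_integral => t /[!inE]/=; rewrite in_itv/= => t01.
  by rewrite momentE.
- move=> y /=; rewrite in_itv/= andbT => y0; apply: continuousM.
    apply: (@continuous_comp _ _ _ (fun y : R => 2 * y) (fun x => x ^+ (2 * n + e))).
      exact: is_derive_continuous.
    exact: exprn_continuous.
  apply: continuousV; first by rewrite expf_neq0// gt_eqF// D0.
  apply: (@continuous_comp _ _ _ (fun y : R => 2 * y + s * (1 + y ^+ 2)) (fun x => x ^+ N)).
    exact: is_derive_continuous.
  exact: exprn_continuous.
- move=> y /=; rewrite in_itv/= andbT => y0.
  by rewrite divr_ge0 ?exprn_ge0 ?(ltW (D0 y y0))// mulr_ge0// ltW.
Qed.

End quadratic.

(** * The triangle and its slices *)

Section triangle.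
Context {R : realType}.
Notation mu := (@lebesgue_measure R).
Notation Ioy := (`]0%R, +oo[%classic : set R).
Implicit Types (x y t s : R) (p : R * R).

(** This is why the single variable s = 2 x y / g governs both f and h. *)
Lemma hE p : h p = g p ^+ 2 - 4 * f p.
Proof.
by case: p => x y; rewrite /h /g /f !big_cons !big_nil /=; ring.
Qed.

Lemma measurable_halfplane (u : R * R -> R) : measurable_fun setT u ->
  measurable [set p | 0 <= u p].
Proof.
move=> mu'; have := mu' measurableT _ (measurable_itv `[0, +oo[).
rewrite setTI; congr (measurable _).
by apply/seteqP; split=> p; rewrite /= in_itv/= andbT.
Qed.

Lemma measurable_open_halfplane (u : R * R -> R) : measurable_fun setT u ->
  measurable [set p | 0 < u p].
Proof.
move=> mu'; have := mu' measurableT _ (measurable_itv `]0, +oo[).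
rewrite setTI; congr (measurable _).
by apply/seteqP; split=> p; rewrite /= in_itv/= andbT.
Qed.

Lemma measurable_Delta : measurable (@Delta R).
Proof.
have -> : @Delta R = [set p | 0 <= p.1] `&` [set p | 0 <= p.2] `&`
    [set p | 0 <= 1 - p.1 - p.2].
  by apply/seteqP; split=> p /= => [[]|[[]]].
by do 2?apply: measurableI; apply: measurable_halfplane => //; do 2?apply: measurable_funB.
Qed.

Lemma measurable_triangle_integrand m n k :
  measurable_fun setT (@triangle_integrand R m n k).
Proof.
have mX1 : measurable_fun [set: R * R] (fun p : R * R => p.1 ^+ 2).
  by apply: measurable_funX.
have mX2 : measurable_fun [set: R * R] (fun p : R * R => p.2 ^+ 2).
  by apply: measurable_funX.
have mf : measurable_fun [set: R * R] (@f R) by exact: measurable_funM.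
have mg : measurable_fun [set: R * R] (@g R).
  by apply: measurable_funB => //; exact: measurable_funB.
have mh : measurable_fun [set: R * R] (@h R).
  rewrite (_ : @h R = fun p => g p ^+ 2 - 4 * f p); last first.
    by apply/funext => p; exact: hE.
  by apply: measurable_funB; [exact: measurable_funX|exact: measurable_funM].
rewrite /triangle_integrand; apply: measurable_funM.
  by apply: measurable_funM; exact: measurable_funX.
by apply: (measurableT_comp measurable_inv); exact: measurable_funX.
Qed.

Lemma h_ge0 p : Delta p -> 0 <= h p.
Proof.
case: p => x y [/= x0 y0 xy]; rewrite /h !big_cons !big_nil /= !mulr1 !mul1r.
by rewrite !mulr_ge0//; lra.
Qed.

Lemma g_ge0 p : Delta p -> 0 <= g p.
Proof. by case: p => x y [/= x0 y0 xy]; rewrite /g/=; nra. Qed.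

Lemma triangle_integrand_ge0 m n k p : Delta p -> 0 <= triangle_integrand m n k p.
Proof.
move=> Dp; rewrite /triangle_integrand divr_ge0 ?mulr_ge0 ?exprn_ge0 ?h_ge0 ?g_ge0//.
by rewrite /f mulr_ge0 ?sqr_ge0.
Qed.

Lemma g_gt0 x y : 0 < x -> 0 < y -> x + y < 1 -> 0 < g (x, y).
Proof. by move=> x0 y0 xy; rewrite /g/=; nra. Qed.

Lemma continuous_triangle_integrand m n k (u v : R -> R) t :
  {for t, continuous u} -> {for t, continuous v} ->
  0 < u t -> 0 < v t -> u t + v t < 1 ->
  {for t, continuous (fun t => triangle_integrand m n k (u t, v t))}.
Proof.
move=> cu cv u0 v0 uv.
have cX (w : R -> R) j : {for t, continuous w} -> {for t, continuous (fun t => w t ^+ j)}.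
  by move=> cw; apply: (@continuous_comp _ _ _ w (fun x => x ^+ j)) => //; exact: exprn_continuous.
have cf : {for t, continuous (fun t => f (u t, v t))}.
  by apply: continuousM; exact: cX.
have cg : {for t, continuous (fun t => g (u t, v t))}.
  apply: continuousB; last exact: cX.
  by apply: continuousB; [exact: cst_continuous|exact: cX].
have ch : {for t, continuous (fun t => h (u t, v t))}.
  rewrite (_ : (fun t => _) = fun t => g (u t, v t) ^+ 2 - 4 * f (u t, v t)); last first.
    by apply/funext => z; exact: hE.
  apply: continuousB; first exact: cX.
  by apply: continuousM => //; exact: cst_continuous.
apply: continuousM; first by apply: continuousM; exact: cX.
apply: continuousV; last exact: cX.
by rewrite expf_neq0// gt_eqF// g_gt0.
Qed.

(** The boundary of the triangle is dropped here, slice by slice. *)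
Lemma integral_triangle_slices m n k :
  (\int[lebesgue_plane R]_(p in @Delta R) (triangle_integrand m n k p)%:E =
   \int[mu]_(x in I01) \int[mu]_(y in `]0%R, (1 - x)%R[)
     (triangle_integrand m n k (x, y))%:E)%E.
Proof.
have mE : measurable_fun setT (EFin \o @triangle_integrand R m n k).
  by apply/measurable_EFinP; exact: measurable_triangle_integrand.
have E0 p : Delta p -> (0 <= (EFin \o @triangle_integrand R m n k) p)%E.
  by move=> Dp; rewrite /= lee_fin triangle_integrand_ge0.
have [E _] := tonelli_plane (@Delta R) _ measurable_Delta mE E0.
have mS := measurable_integral_section (@Delta R) _ measurable_Delta mE E0.
apply: (etrans E) => {E}.
have mtri x D : measurable_fun (D : set R) (fun y => (triangle_integrand m n k (x, y))%:E).
  apply: measurable_funTS; apply: (measurableT_comp mE).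
  exact: measurable_pair1.
transitivity (\int[mu]_(x in `[0%R, 1%R])
    \int[mu]_(y in [set y | Delta (x, y)]) (triangle_integrand m n k (x, y))%:E)%E.
  rewrite [RHS]integral_mkcond; apply: eq_integral => x _; rewrite patchE.
  case: ifPn => // /negP; rewrite inE /= in_itv/= => x01.
  rewrite (_ : [set y | _] = set0) ?integral_set0//.
  apply/seteqP; split=> // y [/= x0 y0 xy]; apply: x01; apply/andP; split; lra.
rewrite integral_itv_bndoo; last exact: measurable_funTS mS.
apply: eq_integral => x /[!inE]/=; rewrite in_itv/= => x01.
rewrite (_ : [set y | _] = `[0%R, (1 - x)%R]%classic); last first.
  apply/seteqP; split=> y /=; rewrite in_itv/=.
    by move=> [/= x0 y0 xy]; apply/andP; split; lra.
  by move=> /andP[y0 xy]; split => /=; lra.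
by rewrite integral_itv_bndoo//; exact: mtri.
Qed.

End triangle.

(** * The coordinates (y / x, 2 x y / g) on the triangle *)

Section polar.
Context {R : realType}.
Notation mu := (@lebesgue_measure R).
Notation Ioy := (`]0%R, +oo[%classic : set R).
Implicit Types (x y t s tau : R) (p : R * R).

Let D tau s := 2 * tau + s * (1 + tau ^+ 2).

Let D_gt0 tau s : 0 < tau -> 0 < s -> 0 < D tau s.
Proof. by move=> t0 s0; rewrite /D !(addr_gt0, mulr_gt0, exprn_gt0). Qed.

(** The abscissa x of the point of the triangle with y / x = tau and
    2 x y = s (1 - x^2 - y^2). *)
Definition radius tau s := Num.sqrt (s / D tau s).

Let radius_sqr tau s : 0 < tau -> 0 < s -> radius tau s ^+ 2 = s / D tau s.
Proof. by move=> t0 s0; rewrite sqr_sqrtr// divr_ge0 ?ltW ?D_gt0. Qed.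

Lemma radius_gt0 tau s : 0 < tau -> 0 < s -> 0 < radius tau s.
Proof. by move=> t0 s0; rewrite sqrtr_gt0 divr_gt0 ?D_gt0. Qed.

(** The bound is the abscissa at which the ray of slope tau leaves the
    triangle. *)
Lemma radius_lt tau s : 0 < tau -> 0 < s < 1 -> radius tau s < (1 + tau)^-1.
Proof.
move=> t0 /andP[s0 s1]; have t1 : 0 < 1 + tau by rewrite addr_gt0.
rewrite -(@ltr_pXn2r _ 2)// ?nnegrE ?invr_ge0 ?sqrtr_ge0 ?ltW// radius_sqr//.
rewrite exprVn ltr_pdivrMr ?D_gt0// mulrC ltr_pdivlMr ?exprn_gt0// /D; nra.
Qed.

Lemma radius_incr tau : 0 < tau -> {in I01 &, {homo radius tau : s s' / s < s'}}.
Proof.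
move=> t0 s s' /[!inE]/=; rewrite !in_itv/= => /andP[s0 _] /andP[s0' _] ss'.
rewrite /radius ltr_sqrt ?divr_gt0 ?D_gt0//.
rewrite ltr_pdivrMr ?D_gt0// mulrAC ltr_pdivlMr ?D_gt0// /D; nra.
Qed.

Definition radius' tau s := tau / (D tau s ^+ 2 * radius tau s).

Lemma is_derive_radius tau s : 0 < tau -> 0 < s ->
  is_derive s 1 (radius tau) (radius' tau s).
Proof.
move=> t0 s0; have D0 := D_gt0 tau s t0 s0; have r0 := radius_gt0 tau s t0 s0.
have Dn0 : D tau s != 0 by rewrite gt_eqF.
have dD : is_derive s 1 (D tau) (1 + tau ^+ 2).
  by apply: is_derive_eq; rewrite /GRing.scale/=; ring.
have dV := @is_deriveV R (D tau) s _ 1 Dn0 dD.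
have dq : is_derive s 1 (fun s => s / D tau s) (2 * tau / D tau s ^+ 2).
  apply: is_derive_eq; rewrite /GRing.scale/= /D; field.
  by move: Dn0; rewrite /D.
have q0 : 0 < s / D tau s by rewrite divr_gt0.
have dr : is_derive s 1 (radius tau) _ :=
  @is_derive1_comp R Num.sqrt (fun s => s / D tau s) s _ _ (is_derive1_sqrt q0) dq.
apply: is_derive_eq.
by rewrite /radius' -/(radius tau s); field; rewrite !gt_eqF.
Qed.

Lemma radius_surj tau x : 0 < tau -> 0 < x < (1 + tau)^-1 ->
  exists2 s, 0 < s < 1 & radius tau s = x.
Proof.
move=> t0 /andP[x0 xt]; have t1 : 0 < 1 + tau by rewrite addr_gt0.
have xt1 : x * (1 + tau) < 1 by rewrite -ltr_pdivlMr// div1r.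
have sq : (x * (1 + tau)) ^+ 2 < 1 by rewrite exprn_ilt1// mulr_ge0 ?ltW.
have d0 : 0 < 1 - (1 + tau ^+ 2) * x ^+ 2 by nra.
have s0 : 0 < 2 * tau * x ^+ 2 / (1 - (1 + tau ^+ 2) * x ^+ 2).
  by rewrite divr_gt0// !mulr_gt0 ?exprn_gt0.
exists (2 * tau * x ^+ 2 / (1 - (1 + tau ^+ 2) * x ^+ 2)).
  by rewrite s0/= ltr_pdivrMr//; nra.
rewrite /radius (_ : _ / _ = x ^+ 2) ?sqrtr_sqr ?gtr0_norm//.
by rewrite /D; field; rewrite !gt_eqF//; nra.
Qed.

Section integrand.
Variables (m n k : nat) (e : bool).
Hypothesis mk : (k + e = 2 * m + 1)%N.

Lemma triangle_integrand_polar tau s : 0 < tau -> 0 < s < 1 ->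
  triangle_integrand m n k (radius tau s, radius tau s * tau) * radius tau s *
    radius' tau s =
  2^-1 * 4 ^- n * (s ^+ (2 * n) * (1 - s ^+ 2) ^+ m) *
    ((2 * tau) ^+ (2 * n + e) / D tau s ^+ (2 * n + 1 + e)).
Proof.
move=> t0 s01; have s0 := proj1 (andP s01).
have D0 := D_gt0 tau s t0 s0; have r0 := radius_gt0 tau s t0 s0.
have Dn0 : D tau s != 0 by rewrite gt_eqF.
(* c is the value of g, kept abstract so that its powers are not expanded. *)
have [c cE] : exists c, c = 2 * tau / D tau s by exists (2 * tau / D tau s).
have c0 : c != 0 by rewrite cE gt_eqF// divr_gt0 ?mulr_gt0.
have rE := radius_sqr tau s t0 s0.
have gE : g (radius tau s, radius tau s * tau) = c.
  rewrite /g/= exprMn rE cE; rewrite /D in Dn0 *; field; exact: Dn0.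
have fE : f (radius tau s, radius tau s * tau) = 4^-1 * (c ^+ 2 * s ^+ 2).
  by rewrite /f/= exprMn rE cE; field.
rewrite /triangle_integrand hE gE fE.
rewrite (_ : _ ^+ 2 - _ = c ^+ 2 * (1 - s ^+ 2)); last by field.
have -> : (2 * tau) ^+ (2 * n + e) / D tau s ^+ (2 * n + 1 + e) =
    c ^+ n * c ^+ n * c ^+ e / D tau s.
  rewrite -!exprD addnn -mul2n cE expr_div_n addnAC addn1 exprSr.
  by rewrite invfM mulrA.
have -> : s ^+ (2 * n) = s ^+ n * s ^+ n by rewrite -exprD addnn mul2n.
rewrite -mulrA (_ : radius tau s * _ = c / (2 * D tau s)); last first.
  by rewrite /radius' cE; field; rewrite !gt_eqF.
have ck : c ^+ e = c ^+ m * c ^+ m * c / c ^+ k.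
  apply: (mulIf (expf_neq0 k c0)); rewrite divfK ?expf_neq0//.
  by rewrite -!exprD -exprSr addnC mk addnn -mul2n addn1.
rewrite ck !exprMn exprVn; field.
by rewrite Dn0 !expf_neq0.
Qed.

(** First y = x tau for fixed x, then Tonelli's theorem on the region
    x (1 + tau) < 1, then x = radius tau s for fixed tau. *)
Lemma integral_triangle_polar :
  (\int[mu]_(x in I01) \int[mu]_(y in `]0%R, (1 - x)%R[)
     (triangle_integrand m n k (x, y))%:E =
   \int[mu]_(tau in Ioy) \int[mu]_(s in I01)
     (2^-1 * 4 ^- n * (s ^+ (2 * n) * (1 - s ^+ 2) ^+ m) *
       ((2 * tau) ^+ (2 * n + e) /
         (2 * tau + s * (1 + tau ^+ 2)) ^+ (2 * n + 1 + e)))%:E)%E.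
Proof.
pose H (p : R * R) := triangle_integrand m n k (p.1, p.1 * p.2) * p.1.
pose S : set (R * R) := [set p | 0 < p.1] `&` [set p | 0 < p.2] `&`
  [set p | 0 < 1 - p.1 * (1 + p.2)].
have mS : measurable S.
  apply: measurableI; first apply: measurableI; apply: measurable_open_halfplane => //.
  apply: measurable_funB => //; apply: measurable_funM => //.
  exact: measurable_funD.
have mH : measurable_fun setT (EFin \o H).
  apply/measurable_EFinP; apply: measurable_funM => //.
  apply: (measurableT_comp (measurable_triangle_integrand m n k)).
  apply/measurable_fun_pairP; split; first exact: measurable_fst.
  exact: (measurable_funM measurable_fst measurable_snd).
have H0 p : S p -> (0 <= (EFin \o H) p)%E.
  case: p => x tau [[/= x0 t0] d0]; rewrite lee_fin mulr_ge0 ?(ltW x0)//.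
  apply: triangle_integrand_ge0; split => /=; [lra|nra|nra].
have [E1 E2] := tonelli_plane S _ mS mH H0.
transitivity (\int[mu]_x \int[mu]_(tau in [set tau | S (x, tau)]) (H (x, tau))%:E)%E.
  rewrite integral_mkcond; apply: eq_integral => x _; rewrite patchE.
  case: ifPn => [|/negP]; rewrite inE /= in_itv/= => x01; last first.
    rewrite (_ : [set y | _] = set0) ?integral_set0//.
    apply/seteqP; split=> // tau [[/= x0 t0] d0]; apply: x01; apply/andP; split; nra.
  have [x0 x1] := andP x01.
  have b0 : 0 < (1 - x) / x by rewrite divr_gt0 ?subr_gt0.
  have -> : [set tau | S (x, tau)] = `]0%R, ((1 - x) / x)%R[%classic.
    apply/seteqP; split=> tau /=; rewrite /S/= in_itv/=.
      move=> [[/= _ t0] d0]; rewrite t0/= ltr_pdivlMr//; lra.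
    by move=> /andP[t0]; rewrite ltr_pdivlMr// => d0; split; [split|lra].
  apply: (@ge0_substitution_increasing R `]0%R, ((1 - x) / x)%R[%classic
    `]0%R, (1 - x)%R[%classic ( *%R x) (cst x)
    (fun y => triangle_integrand m n k (x, y))) => //.
  - exact: compactly_exhausted_itv0b.
  - move=> tau /=; rewrite !in_itv/= => /andP[t0].
    by rewrite ltr_pdivlMr// mulr_gt0//= mulrC.
  - by move=> tau _; apply: is_derive_eq; rewrite /GRing.scale/=; ring.
  - by move=> tau _; exact: cst_continuous.
  - move=> y /=; rewrite in_itv/= => /andP[y0 y1].
    apply: (continuous_triangle_integrand m n k (cst x) id); rewrite //=; last by lra.
    exact: cst_continuous.
  - move=> y /=; rewrite in_itv/= => y01; apply: triangle_integrand_ge0.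
    by split => /=; lra.
  - move=> y /=; rewrite in_itv/= => /andP[y0 y1]; exists (y / x), (y / x).
    by rewrite /= !in_itv/= divr_gt0//= ltr_pM2r ?invr_gt0// mulrC divfK ?gt_eqF.
  - by move=> u v _ _ uv; rewrite ltr_pM2l.
  - by move=> tau _; exact: ltW.
apply: (etrans (esym E1)); apply: (etrans E2) => {E1 E2}.
rewrite [RHS]integral_mkcond; apply: eq_integral => tau _; rewrite patchE.
case: ifPn => [|/negP]; rewrite inE /= in_itv/= andbT => t0; last first.
  rewrite (_ : [set x | _] = set0) ?integral_set0//.
  by apply/seteqP; split=> // x [[/= _ /t0]].
have t1 : 0 < 1 + tau by rewrite addr_gt0.
have -> : [set x | S (x, tau)] = `]0%R, ((1 + tau)^-1)%R[%classic.
  apply/seteqP; split=> x /=; rewrite /S/= in_itv/=.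
    by move=> [[/= x0 _] d0]; rewrite x0/= -div1r ltr_pdivlMr//; lra.
  by move=> /andP[x0]; rewrite -div1r ltr_pdivlMr// => d0; split; [split|lra].
transitivity (\int[mu]_(s in I01) (H (radius tau s, tau) * radius' tau s)%:E)%E.
  apply: (@ge0_substitution_increasing R I01 `]0%R, ((1 + tau)^-1)%R[%classic
    (radius tau) (radius' tau) (fun x => H (x, tau))) => //.
  - exact: compactly_exhausted_itv0b.
  - move=> s /=; rewrite !in_itv/= => s01.
    by rewrite radius_lt// radius_gt0//; case/andP: s01.
  - by move=> s /=; rewrite in_itv/= => /andP[s0 _]; exact: is_derive_radius.
  - move=> s /=; rewrite in_itv/= => /andP[s0 _].
    apply: continuousM; first exact: cst_continuous.
    apply: continuousV.
      by rewrite mulf_neq0 ?expf_neq0// gt_eqF ?D_gt0 ?radius_gt0.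
    apply: continuousM; last exact: is_derive_continuous (is_derive_radius tau s t0 s0).
    exact: (is_derive_continuous (fun s => D tau s ^+ 2)).
  - move=> x /=; rewrite in_itv/= => /andP[x0]; rewrite -div1r ltr_pdivlMr// => xt.
    apply: continuousM; last exact: is_derive_continuous.
    apply: (continuous_triangle_integrand m n k id (fun x => x * tau)) => //=.
    + exact: is_derive_continuous.
    + by rewrite mulr_gt0.
    + by lra.
  - move=> x /=; rewrite in_itv/= => /andP[x0]; rewrite -div1r ltr_pdivlMr// => xt.
    by rewrite -lee_fin; apply: (H0 (x, tau)); split; [split|rewrite /=; lra].
  - move=> x /=; rewrite in_itv/= => x01; have [s s01 rs] := radius_surj tau x t0 x01.
    by exists s, s; rewrite /= in_itv/= rs.
  - exact: radius_incr.
  - move=> s /=; rewrite in_itv/= => /andP[s0 _].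
    by rewrite /radius' divr_ge0 ?(ltW t0)// mulr_ge0 ?sqr_ge0 ?sqrtr_ge0.
apply: eq_integral => s /[!inE]/=; rewrite in_itv/= => s01; congr EFin.
exact: triangle_integrand_polar.
Qed.

End integrand.
End polar.

(** * The triangle integral as an Euler integral *)

Section reduction.
Context {R : realType}.
Notation mu := (@lebesgue_measure R).
Notation Ioy := (`]0%R, +oo[%classic : set R).
Implicit Types (x y t s w tau : R).

Lemma integral_sqrt_onem (G : R -> R) :
  (forall y, I01 y -> {for y, continuous G}) -> (forall y, I01 y -> 0 <= G y) ->
  (\int[mu]_(s in I01) (G s)%:E =
   \int[mu]_(w in I01) (G (Num.sqrt (1 - w)) / (2 * Num.sqrt (1 - w)))%:E)%E.
Proof.
move=> cG G0.
transitivity (\int[mu]_(w in I01)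
    (G (Num.sqrt (1 - w)) * - - (2 * Num.sqrt (1 - w))^-1)%:E)%E; last first.
  by apply: eq_integral => w _; rewrite opprK.
have sqrt01 w : 0 < w < 1 -> 0 < Num.sqrt (1 - w) < 1.
  move=> /andP[w0 w1]; rewrite sqrtr_gt0 subr_gt0 w1 -[ltRHS]sqrtr1 ltr_sqrt//.
  by rewrite gtrBl.
apply: (@ge0_substitution_decreasing R I01 I01 (fun w => Num.sqrt (1 - w))
  (fun w => - (2 * Num.sqrt (1 - w))^-1) G) => //.
- exact: compactly_exhausted_itv0b.
- move=> w /=; rewrite in_itv/= => /andP[w0 w1].
  have w1' : 0 < 1 - w by rewrite subr_gt0.
  have d1 : is_derive w 1 (fun w => 1 - w) (- 1).
    by apply: is_derive_eq; ring.
  have D : is_derive w 1 (fun w => Num.sqrt (1 - w)) _ :=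
    @is_derive1_comp R Num.sqrt (fun w => 1 - w) w _ _ (is_derive1_sqrt w1') d1.
  by apply: is_derive_eq; rewrite mulrN1.
- move=> w /=; rewrite in_itv/= => /andP[w0 w1]; apply: continuousN.
  apply: continuousV; first by rewrite mulf_neq0// gt_eqF// sqrtr_gt0 subr_gt0.
  apply: continuousM; first exact: cst_continuous.
  apply: (@continuous_comp _ _ _ (fun w => 1 - w) Num.sqrt).
    exact: is_derive_continuous.
  exact: sqrt_continuous.
- move=> y /=; rewrite in_itv/= => /andP[y0 y1]; exists (1 - y ^+ 2), (1 - y ^+ 2).
  have -> : 1 - (1 - y ^+ 2) = y ^+ 2 by ring.
  rewrite sqrtr_sqr gtr0_norm// /= in_itv/= lexx subr_gt0 gtrBl.
  by rewrite exprn_ilt1 ?exprn_gt0 ?ltW.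
- move=> w w' /[!inE]/=; rewrite !in_itv/= => /andP[w0 w1] /andP[w0' w1'] ww.
  by rewrite ltr_sqrt ?subr_gt0// ltrD2l ltrN2.
Qed.

Section params.
Variables (m n k : nat) (e : bool).
Hypothesis mk : (k + e = 2 * m + 1)%N.

Let P (p : R * R) := 2^-1 * 4 ^- n * (p.2 ^+ (2 * n) * (1 - p.2 ^+ 2) ^+ m) *
  ((2 * p.1) ^+ (2 * n + e) / (2 * p.1 + p.2 * (1 + p.1 ^+ 2)) ^+ (2 * n + 1 + e)).

Let C s := 2^-1 * 4 ^- n * (s ^+ (2 * n) * (1 - s ^+ 2) ^+ m).

Let Q (p : R * R) := C p.1 * (2^-1 * (p.2 `^ (n%:R - 2^-1 + e%:R) *
  (1 - p.2) `^ n%:R * (1 - (1 - p.1 ^+ 2) * p.2) `^ (- (n%:R + 1)))).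

Let C_ge0 s : 0 < s < 1 -> 0 <= C s.
Proof.
move=> /andP[s0 s1]; rewrite /C !mulr_ge0 ?invr_ge0 ?exprn_ge0 ?(ltW s0)//.
by rewrite subr_ge0 exprn_ile1 ?ltW.
Qed.

Let T_ge0 tau s : 0 < tau -> 0 < s -> 0 <= (2 * tau) ^+ (2 * n + e) /
  (2 * tau + s * (1 + tau ^+ 2)) ^+ (2 * n + 1 + e).
Proof.
move=> t0 s0; have d0 : 0 < 2 * tau + s * (1 + tau ^+ 2).
  by rewrite !(addr_gt0, mulr_gt0, exprn_gt0).
by rewrite divr_ge0// exprn_ge0// ?(ltW d0)// mulr_ge0// ltW.
Qed.

Let mX (u : R * R -> R) j : measurable_fun setT u -> measurable_fun setT (fun p => u p ^+ j).
Proof. by move=> mu'; exact: measurable_funX. Qed.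

Let mC : measurable_fun setT C.
Proof.
apply: measurable_funM => //; apply: measurable_funM; first exact: measurable_funX.
by apply: measurable_funX; apply: measurable_funB => //; exact: measurable_funX.
Qed.

Let mP : measurable_fun setT (EFin \o P).
Proof.
apply/measurable_EFinP; apply: measurable_funM.
  exact: (measurableT_comp mC measurable_snd).
apply: measurable_funM; first by apply: mX; apply: measurable_funM.
apply: (measurableT_comp measurable_inv); apply: mX; apply: measurable_funD.
  exact: measurable_funM.
by apply: measurable_funM => //; apply: measurable_funD => //; exact: mX.
Qed.

Let mQ : measurable_fun setT (EFin \o Q).
Proof.
have mpow (u : R * R -> R) a :
    measurable_fun setT u -> measurable_fun setT (fun p => u p `^ a).
  by move=> mu'; exact: (measurableT_comp (measurable_powR _)).
apply/measurable_EFinP; apply: measurable_funM.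
  exact: (measurableT_comp mC measurable_fst).
apply: measurable_funM => //; apply: measurable_funM; first apply: measurable_funM.
- exact: mpow.
- by apply: mpow; exact: measurable_funB.
- apply: mpow; apply: measurable_funB => //; apply: measurable_funM => //.
  by apply: measurable_funB => //; exact: mX.
Qed.

Let Q_ge0 s t : 0 < s < 1 -> 0 <= Q (s, t).
Proof.
by move=> s01; apply: mulr_ge0; [exact: C_ge0|rewrite !mulr_ge0 ?powR_ge0].
Qed.

Let QE t w : 0 < t < 1 -> 0 < w < 1 ->
  Q (Num.sqrt (1 - w), t) / (2 * Num.sqrt (1 - w)) = 2 ^- (2 * n + 3) *
    euler_kernel (n%:R - 2^-1 + e%:R) n%:R m%:R (n%:R - 2^-1) (- (n%:R + 1)) (t, w).
Proof.
move=> t01 /andP[w0 w1]; have w1' : 0 < 1 - w by rewrite subr_gt0.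
rewrite /Q /C /= exprM sqr_sqrtr ?ltW// (_ : 1 - (1 - w) = w); last by ring.
rewrite /euler_kernel/= [t * w]mulrC (powR_mulrn m) ?(ltW w0)//.
rewrite -(powR_mulrn n (ltW w1')).
rewrite powRB; last by apply/implyP => _; rewrite gt_eqF.
have -> : 2 ^+ (2 * n + 3) = 8 * 4 ^+ n :> R.
  rewrite exprD exprM mulrC (_ : 2 ^+ 3 = 8 :> R); last by ring.
  by rewrite (_ : 2 ^+ 2 = 4 :> R)//; ring.
rewrite powR12_sqrt ?ltW//.
by field; rewrite !gt_eqF ?exprn_gt0 ?sqrtr_gt0.
Qed.

(** For fixed s the integral over tau is given by the quadratic transformation;
    for fixed t the variable s is then replaced by w = 1 - s^2. *)
Lemma integral_triangle_euler :
  (\int[lebesgue_plane R]_(p in @Delta R) (triangle_integrand m n k p)%:E =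
   (2 ^- (2 * n + 3))%:E *
   euler_integral (n%:R - 2^-1 + e%:R) n%:R m%:R (n%:R - 2^-1) (- (n%:R + 1)))%E.
Proof.
rewrite integral_triangle_slices (integral_triangle_polar m n k e mk).
have P0 tau s : Ioy tau -> I01 s -> (0 <= (EFin \o P) (tau, s))%E.
  rewrite /= !in_itv/= andbT => t0 s01; rewrite lee_fin; have [s0 _] := andP s01.
  apply: mulr_ge0; first exact: (C_ge0 s s01).
  exact: T_ge0.
have [_ E] := tonelli_rectangle Ioy I01 (EFin \o P) (measurable_itv _)
  (measurable_itv _) mP P0.
apply: (etrans E) => {E P0}.
transitivity (\int[mu]_(s in I01) \int[mu]_(t in I01) (Q (s, t))%:E)%E.
  apply: eq_integral => s /[!inE]/=; rewrite in_itv/= => s01.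
  have [s0 _] := andP s01.
  transitivity ((C s)%:E * \int[mu]_(tau in Ioy) ((2 * tau) ^+ (2 * n + e) /
      (2 * tau + s * (1 + tau ^+ 2)) ^+ (2 * n + 1 + e))%:E)%E.
    rewrite -ge0_integralZl; last 4 first.
    - exact: measurable_itv.
    - apply/measurable_EFinP/measurable_funTS; apply: measurable_funM.
        by apply: measurable_funX; exact: measurable_funM.
      apply: (measurableT_comp measurable_inv); apply: measurable_funX.
      apply: measurable_funD; first exact: measurable_funM.
      by apply: measurable_funM => //; apply: measurable_funD => //; exact: measurable_funX.
    - move=> tau /=; rewrite in_itv/= andbT => t0; rewrite lee_fin.
      exact: T_ge0.
    - by rewrite lee_fin C_ge0.
    by apply: eq_integral => tau _; rewrite -EFinM.
  rewrite integral_slope_moment// -ge0_integralZl; last 4 first.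
  - exact: measurable_itv.
  - apply/measurable_EFinP/measurable_funTS; apply: measurable_funM => //.
    apply: measurable_funM; first apply: measurable_funM.
    + exact: measurable_powR.
    + by apply: (measurableT_comp (measurable_powR _)); exact: measurable_funB.
    + by apply: (measurableT_comp (measurable_powR _)); exact: measurable_funB.
  - by move=> t _; rewrite lee_fin !mulr_ge0 ?powR_ge0.
  - by rewrite lee_fin C_ge0.
  by apply: eq_integral => t _; rewrite -EFinM.
have Q0 s t : I01 s -> I01 t -> (0 <= (EFin \o Q) (s, t))%E.
  by rewrite /= !in_itv/= => s01 _; rewrite lee_fin Q_ge0.
have [_ E] := tonelli_rectangle I01 I01 (EFin \o Q) (measurable_itv _)
  (measurable_itv _) mQ Q0.
apply: (etrans E) => {E Q0}.
rewrite /euler_integral -ge0_integralZl; last 4 first.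
- exact: measurable_itv.
- apply: measurable_funTS.
  apply: (@measurable_integral_snd _ I01 (EFin \o euler_kernel _ _ _ _ _)).
  + exact: measurable_itv.
  + by apply/measurable_EFinP; exact: measurable_euler_kernel.
  + by move=> x y _; exact: euler_kernel_ge0.
- by move=> t _; apply: integral_ge0 => w _; exact: euler_kernel_ge0.
- by rewrite lee_fin invr_ge0 exprn_ge0.
apply: eq_integral => t /[!inE]/=; rewrite in_itv/= => t01.
rewrite (integral_sqrt_onem (fun s => Q (s, t))); last 2 first.
- move=> s /=; rewrite in_itv/= => /andP[s0 s1].
  have cX j (u : R -> R) : {for s, continuous u} -> {for s, continuous (fun s => u s ^+ j)}.
    by move=> cu; apply: (@continuous_comp _ _ _ u (fun x => x ^+ j)) => //; exact: exprn_continuous.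
  have cs : {for s, continuous (fun s => 1 - s ^+ 2)} by exact: is_derive_continuous.
  apply: continuousM.
    apply: continuousM; first exact: cst_continuous.
    by apply: continuousM; apply: cX => //; exact: is_derive_continuous.
  apply: continuousM; first exact: cst_continuous.
  apply: continuousM; first exact: cst_continuous.
  apply: (continuous_powR_comp (fun s => 1 - (1 - s ^+ 2) * t)); last by rewrite /=; nra.
  apply: continuousB; first exact: cst_continuous.
  by apply: continuousM => //; exact: cst_continuous.
- by move=> s /=; rewrite in_itv/= => s01; exact: Q_ge0.
rewrite -ge0_integralZl; last 4 first.
- exact: measurable_itv.
- apply: measurable_funTS.
  apply: (measurableT_comp (f := EFin \o euler_kernel _ _ _ _ _)); last exact: measurable_pair1.
  by apply/measurable_EFinP; exact: measurable_euler_kernel.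
- by move=> w _; exact: euler_kernel_ge0.
- by rewrite lee_fin invr_ge0 exprn_ge0.
apply: eq_integral => w /[!inE]/=; rewrite in_itv/= => w01.
by rewrite -EFinM QE.
Qed.

End params.
End reduction.

(** * Convergence *)

Section finiteness.
Context {R : realType}.
Notation mu := (@lebesgue_measure R).
Implicit Types (a b c d k x y : R).

Lemma euler_integral_ge0 a b c d k : (0 <= euler_integral a b c d k :> \bar R)%E.
Proof.
by apply: integral_ge0 => x _; apply: integral_ge0 => y _; exact: euler_kernel_ge0.
Qed.

(** Finiteness of a product with a positive factor passes to the other factor;
    this is how convergence propagates along the identities. *)
Lemma fin_num_factor (x y z : \bar R) :
  (x * y = z)%E -> (0 < x)%E -> (0 <= y)%E -> z \is a fin_num -> y \is a fin_num.
Proof.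
move=> <- x0 y0 xyfin; rewrite ge0_fin_numE//.
case: y y0 xyfin => [y _ _|_|//]; first exact: ltry.
by rewrite gt0_muley.
Qed.

Lemma gamma_integralD_fin a b :
  gamma_integral a \is a fin_num -> gamma_integral b \is a fin_num ->
  gamma_integral (a + b) \is a fin_num.
Proof.
move=> Ga Gb; apply: (@fin_num_factor (beta_integral a b)); last exact: (fin_numM Ga Gb).
- by rewrite muleC; exact: esym (gamma_integralM a b).
- exact: beta_integral_gt0.
- exact: ltW (gamma_integral_gt0 _).
Qed.

Lemma beta_integral_fin a b :
  gamma_integral a \is a fin_num -> gamma_integral b \is a fin_num ->
  beta_integral a b \is a fin_num.
Proof.
move=> Ga Gb; apply: (@fin_num_factor (gamma_integral (a + b))); last exact: (fin_numM Ga Gb).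
- exact: esym (gamma_integralM a b).
- exact: gamma_integral_gt0.
- exact: ltW (beta_integral_gt0 _ _).
Qed.

(** Starting from Gamma(1/2), the product formula shows that the finiteness of
    Gamma(a) and Gamma(b) implies that of Gamma(a + b). *)
Lemma gamma_integral_fin j : gamma_integral (j%:R + 2^-1 : R) \is a fin_num.
Proof.
have half : gamma_integral (2^-1 : R) \is a fin_num.
  rewrite ge0_fin_numE; first exact: gamma_integral_half.
  exact: ltW (gamma_integral_gt0 _).
elim: j => [|j IH]; first by rewrite add0r.
rewrite (_ : j.+1%:R + 2^-1 = j%:R + 2^-1 + 2^-1 + 2^-1); last first.
  by rewrite -addn1 natrD; field.
by apply: (gamma_integralD_fin _ _ (gamma_integralD_fin _ _ IH half) half).
Qed.

Let ratio (ga gb gc gd gs B1 B2 J S : \bar R) :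
  ga \is a fin_num -> gb \is a fin_num -> gc \is a fin_num -> gd \is a fin_num ->
  gs \is a fin_num -> B1 \is a fin_num -> B2 \is a fin_num -> J \is a fin_num ->
  S \is a fin_num -> (0 < gs)%E -> (0 < B1)%E ->
  (ga * gb = gs * B1)%E -> (gc * gd = gs * B2)%E -> (B1 * J = B2 * S)%E ->
  fine J = fine gc * fine gd / (fine ga * fine gb) * fine S.
Proof.
case: ga => [ga _||]//; case: gb => [gb _||]//; case: gc => [gc _||]//.
case: gd => [gd _||]//; case: gs => [gs _||]//; case: B1 => [B1 _||]//.
case: B2 => [B2 _||]//; case: J => [J _||]//; case: S => [S _||]//.
rewrite !lte_fin => gs0 B10 [E1] [E2] [E3].
rewrite /= E1 E2; have b0 : B1 != 0 by rewrite gt_eqF.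
by apply: (mulfI b0); rewrite E3; field; rewrite b0 gt_eqF.
Qed.

(** The two beta functions share the factor Gamma(a + b) = Gamma(c + d), which
    drops out of their quotient. *)
Lemma beta_integral_ratio a b c d (J S : \bar R) : a + b = c + d ->
  gamma_integral a \is a fin_num -> gamma_integral b \is a fin_num ->
  gamma_integral c \is a fin_num -> gamma_integral d \is a fin_num ->
  (0 <= S)%E -> J \is a fin_num -> (beta_integral a b * J = beta_integral c d * S)%E ->
  S \is a fin_num /\
  fine J = fine (gamma_integral c) * fine (gamma_integral d) /
    (fine (gamma_integral a) * fine (gamma_integral b)) * fine S.
Proof.
move=> abcd Ga Gb Gc Gd S0 Jf JS.
have [B1 B2] := (beta_integral_fin a b Ga Gb, beta_integral_fin c d Gc Gd).
have Sf : S \is a fin_num.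
  apply: (fin_num_factor _ _ _ (esym JS) (beta_integral_gt0 c d) S0).
  exact: (fin_numM B1 Jf).
split; first exact: Sf.
have E2 := gamma_integralM c d; rewrite -abcd in E2.
exact: (ratio _ _ _ _ _ _ _ _ _ Ga Gb Gc Gd (gamma_integralD_fin a b Ga Gb) B1 B2 Jf Sf
  (gamma_integral_gt0 _) (beta_integral_gt0 a b) (gamma_integralM a b) E2 JS).
Qed.

(** Since 1 - x y >= 1 - y, the factor (1 - y)^m (1 - x y)^-(m + 1/2) is at most
    (1 - y)^(-1/2); all other exponents are at least -1/2, so the integral is
    bounded by B(1/2, 1/2)^2. *)
Lemma euler_integral_fin (m n : nat) (e : bool) :
  (euler_integral (n%:R - 2^-1 + e%:R) (n%:R - 2^-1) (n%:R - 2^-1) m%:R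
     (- (m%:R + 2^-1 : R)) < +oo)%E.
Proof.
pose E (p : R * R) := euler_kernel (2^-1 - 1) (2^-1 - 1) (2^-1 - 1) (2^-1 - 1) 0 p.
have EI : (euler_integral (2^-1 - 1 : R) (2^-1 - 1) (2^-1 - 1) (2^-1 - 1) 0 =
    beta_integral (2^-1 : R) 2^-1 * beta_integral (2^-1 : R) 2^-1)%E.
  have mb : measurable_fun (I01 : set R)
      (fun y : R => (y `^ (2^-1 - 1) * (1 - y) `^ (2^-1 - 1))%:E).
    apply/measurable_EFinP/measurable_funTS; apply: measurable_funM.
      exact: measurable_powR.
    by apply: (measurableT_comp (measurable_powR _)); exact: measurable_funB.
  rewrite {2}/beta_integral -ge0_integralZr; last 4 first.
  - exact: measurable_itv.
  - exact: mb.
  - by move=> x _; rewrite lee_fin mulr_ge0 ?powR_ge0.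
  - exact: ltW (beta_integral_gt0 _ _).
  apply: eq_integral => x _; rewrite /beta_integral -ge0_integralZl; last 4 first.
  - exact: measurable_itv.
  - exact: mb.
  - by move=> y _; rewrite lee_fin mulr_ge0 ?powR_ge0.
  - by rewrite lee_fin mulr_ge0 ?powR_ge0.
  apply: eq_integral => y _; rewrite -EFinM; congr EFin.
  by rewrite /euler_kernel/= powRr0 mulr1 mulrA.
have BB : (beta_integral (2^-1 : R) 2^-1 * beta_integral (2^-1 : R) 2^-1 < +oo)%E.
  have Gh : gamma_integral (2^-1 : R) \is a fin_num.
    by have := gamma_integral_fin 0; rewrite add0r.
  have Bh := beta_integral_fin 2^-1 2^-1 Gh Gh.
  by have := fin_numM Bh Bh; rewrite fin_numElt => /andP[].
apply: le_lt_trans BB; rewrite -EI.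
have mE a b c d k : measurable_fun setT (EFin \o @euler_kernel R a b c d k).
  by apply/measurable_EFinP; exact: measurable_euler_kernel.
have mI a b c d k : measurable_fun (I01 : set R)
    (fun x => \int[mu]_(y in I01) (euler_kernel a b c d k (x, y))%:E)%E.
  apply: measurable_funTS.
  apply: (@measurable_integral_snd _ I01 (EFin \o euler_kernel a b c d k)).
  - exact: measurable_itv.
  - exact: mE.
  - by move=> x y _; exact: euler_kernel_ge0.
apply: ge0_le_integral.
- exact: measurable_itv.
- by move=> x _; apply: integral_ge0 => y _; exact: euler_kernel_ge0.
- exact: mI.
- exact: mI.
move=> x /=; rewrite in_itv/= => x01; apply: ge0_le_integral.
- exact: measurable_itv.
- by move=> y _; exact: euler_kernel_ge0.
- apply: measurable_funTS.
  by apply: (measurableT_comp (mE _ _ _ _ _)); exact: measurable_pair1.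
- apply: measurable_funTS.
  by apply: (measurableT_comp (mE _ _ _ _ _)); exact: measurable_pair1.
move=> y /=; rewrite in_itv/= => y01; rewrite lee_fin /euler_kernel/= powRr0 mulr1.
have [x0 x1 y0 y1] : [/\ 0 < x <= 1, 0 < 1 - x <= 1, 0 < y <= 1 & 0 < 1 - y].
  by split; lra.
have n0 : 0 <= n%:R :> R by [].
have e0 : 0 <= e%:R :> R by [].
rewrite -!mulrA; apply: ler_pM; rewrite ?mulr_ge0 ?powR_ge0//.
  by apply: ger_powR => //; lra.
apply: ler_pM; rewrite ?mulr_ge0 ?powR_ge0//.
  by apply: ger_powR => //; lra.
apply: ler_pM; rewrite ?mulr_ge0 ?powR_ge0//.
  by apply: ger_powR => //; lra.
have -> : (1 - y) `^ (2^-1 - 1) = (1 - y) `^ m%:R * (1 - y) `^ (- (m%:R + 2^-1)).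
  rewrite -powRD; last by apply/implyP => _; rewrite gt_eqF.
  by congr (_ `^ _); field.
rewrite ler_wpM2l ?powR_ge0// !powRN lef_pV2 ?posrE ?powR_gt0//; last by nra.
have m0 : 0 <= m%:R + 2^-1 :> R by rewrite addr_ge0.
by apply: (ge0_ler_powR m0); rewrite ?nnegrE; nra.
Qed.

End finiteness.

(** * Comparison with the integral over the square *)

Section conclusion.
Context {R : realType}.
Notation mu := (@lebesgue_measure R).

Lemma measurable_square_integrand m n k :
  measurable_fun setT (@square_integrand R m n k).
Proof.
have mpow (u : R * R -> R) a :
    measurable_fun setT u -> measurable_fun setT (fun p => u p `^ a).
  by move=> mu'; exact: (measurableT_comp (measurable_powR _)).
have mX (u : R * R -> R) j : measurable_fun setT u -> measurable_fun setT (fun p => u p ^+ j).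
  by move=> mu'; exact: measurable_funX.
rewrite /square_integrand; apply: measurable_funM; first do 3?apply: measurable_funM.
- exact: mpow.
- exact: mX.
- by apply: mX; exact: measurable_funB.
- by apply: mpow; exact: measurable_funB.
- apply: (measurableT_comp measurable_inv); apply: mX.
  by apply: measurable_funB => //; exact: measurable_funM.
Qed.

Lemma square_integrand_ge0 m n k (p : R * R) : unit_square p ->
  0 <= square_integrand m n k p.
Proof.
case: p => x y []; rewrite /= !in_itv/= => x01 y01; rewrite /square_integrand/=.
by rewrite divr_ge0 ?mulr_ge0 ?powR_ge0 ?exprn_ge0//; nra.
Qed.

Lemma integral_square_euler m n k :
  (\int[lebesgue_plane R]_(p in @unit_square R) (square_integrand m n k p)%:E =
   euler_integral (m%:R - 2^-1) n%:R m%:R (n%:R - 2^-1) (- k%:R))%E.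
Proof.
have mE : measurable_fun setT (EFin \o @square_integrand R m n k).
  by apply/measurable_EFinP; exact: measurable_square_integrand.
have E0 x y : `[0%R, 1%R]%classic x -> `[0%R, 1%R]%classic y ->
    (0 <= (EFin \o @square_integrand R m n k) (x, y))%E.
  by move=> x01 y01; rewrite /= lee_fin square_integrand_ge0.
have [E _] := tonelli_rectangle `[0%R, 1%R] `[0%R, 1%R] _ (measurable_itv _)
  (measurable_itv _) mE E0.
have inner x : I01 x ->
    (\int[mu]_(y in `[0%R, 1%R]) (square_integrand m n k (x, y))%:E =
     \int[mu]_(y in I01)
       (euler_kernel (m%:R - 2^-1) n%:R m%:R (n%:R - 2^-1) (- k%:R) (x, y))%:E)%E.
  rewrite /= in_itv/= => x01; rewrite integral_itv_bndoo; last first.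
    by apply: measurable_funTS; apply: (measurableT_comp mE); exact: measurable_pair1.
  apply: eq_integral => y /[!inE]/=; rewrite in_itv/= => y01; congr EFin.
  have [x1 y0 xy] : [/\ 0 <= 1 - x, 0 <= y & 0 <= 1 - x * y] by split; nra.
  by rewrite /square_integrand /euler_kernel/= !powR_mulrn// powR_invn//; ring.
apply: (etrans E); rewrite integral_itv_bndoo.
  by apply: eq_integral => x /[!inE]; exact: inner.
apply: (eq_measurable_fun (fun x => \int[mu]_(y in I01)
  (euler_kernel (m%:R - 2^-1) n%:R m%:R (n%:R - 2^-1) (- k%:R) (x, y))%:E)%E).
  by move=> x /[!inE] x01; rewrite inner.
apply: measurable_funTS; apply: (@measurable_integral_snd _ I01 (EFin \o euler_kernel _ _ _ _ _)).
- exact: measurable_itv.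
- by apply/measurable_EFinP; exact: measurable_euler_kernel.
- by move=> x y _; exact: euler_kernel_ge0.
Qed.

Let eq_euler_integral (a a' b b' c c' d d' r r' : R) :
  a = a' -> b = b' -> c = c' -> d = d' -> r = r' ->
  euler_integral a b c d r = euler_integral a' b' c' d' r'.
Proof. by move=> -> -> -> -> ->. Qed.

(** Both parts at once. In the notation of the proof, a + a' = b + b' is the common
    sum 2 n + 1 + e; J is the Euler integral reached from the triangle after one
    Moebius step, and S is the integral over the square, reached from J by the
    swap of the numerators a and b and a second Moebius step. The condition on m
    makes the argument a' of Gamma positive. *)
Lemma triangle_square_identity (m n k k' : nat) (e : bool) :
  (k + e = 2 * m + 1)%N -> (k' + e = m + 1)%N -> (m <= 2 * n + e)%N ->
  [/\ (lebesgue_plane R).-integrable (@Delta R) (EFin \o @triangle_integrand R m n k),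
      (lebesgue_plane R).-integrable (@unit_square R) (EFin \o @square_integrand R m n k') &
      \int[lebesgue_plane R]_(p in @Delta R) triangle_integrand m n k p =
      2 ^- (2 * n + 3)
      * (Gamma (n%:R + 2^-1) * Gamma (n%:R + 2^-1 + e%:R)
         / (Gamma (2 * n%:R - m%:R + 2^-1 + e%:R) * Gamma (m%:R + 2^-1)))
      * \int[lebesgue_plane R]_(p in @unit_square R) square_integrand m n k' p].
Proof.
move=> mk mk' mn.
pose c : R := 2 ^- (2 * n + 3).
pose a : R := m%:R + 2^-1; pose a' : R := 2 * n%:R - m%:R + 2^-1 + e%:R.
pose b : R := n%:R + 2^-1 + e%:R; pose b' : R := n%:R + 2^-1.
have mkR : k'%:R + e%:R = m%:R + 1 :> R by rewrite -natrD mk' natrD.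
have ab : a + a' = b + b' by rewrite /a /a' /b /b'; ring.
have euler0 := @euler_integral_ge0 R.
have [J JE] : exists J : \bar R, J = euler_integral (b - 1) (b' - 1) (b' - 1) m%:R (- a) by exact: (ex_intro _ _ erefl).
have [S SE] : exists S : \bar R, S = euler_integral (m%:R - 2^-1) n%:R m%:R (n%:R - 2^-1) (- k'%:R : R).
  by exact: (ex_intro _ _ erefl).
have J0 : (0 <= J)%E by rewrite JE; exact: euler0.
have S0 : (0 <= S)%E by rewrite SE; exact: euler0.
have TJ : (\int[lebesgue_plane R]_(p in @Delta R) (triangle_integrand m n k p)%:E =
    c%:E * J)%E.
  rewrite (integral_triangle_euler m n k e mk) euler_integral_mobius JE.
  apply: (congr1 (mule _)); apply: eq_euler_integral => //; rewrite /a /b /b'; by field.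
have JS : (beta_integral a' a * J = beta_integral b' b * S)%E.
  rewrite JE SE (euler_integral_swap_numerators a a' b b' (b' - 1) m%:R ab).
  rewrite euler_integral_mobius.
  have kE : - k'%:R = e%:R - m%:R - 1 :> R by rewrite -[e%:R](addKr k'%:R) mkR; ring.
  apply: (congr1 (mule _)); apply: eq_euler_integral; rewrite ?kE /a /a' /b /b'; by field.
have Jfin : J \is a fin_num.
  rewrite ge0_fin_numE// JE; apply: le_lt_trans (euler_integral_fin m n e).
  rewrite le_eqVlt; apply/orP; left; apply/eqP.
  by apply: eq_euler_integral; rewrite /a /b /b'; field.
have Gn : gamma_integral b' \is a fin_num by exact: gamma_integral_fin.
have Gb : gamma_integral b \is a fin_num.
  by rewrite /b addrAC -natrD; exact: gamma_integral_fin.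
have Ga : gamma_integral a \is a fin_num by exact: gamma_integral_fin.
have Ga' : gamma_integral a' \is a fin_num.
  rewrite (_ : a' = (2 * n + e - m)%:R + 2^-1); first exact: gamma_integral_fin.
  by rewrite /a' natrB// natrD natrM; ring.
have D : a' + a = b' + b by rewrite addrC ab addrC.
have [Sfin ratioE] := beta_integral_ratio a' a b' b J S D Ga' Ga Gn Gb S0 Jfin JS.
have SqS : (\int[lebesgue_plane R]_(p in @unit_square R) (square_integrand m n k' p)%:E = S)%E.
  exact: (etrans (integral_square_euler _ _ _) (esym SE)).
have lty (x : \bar R) : x \is a fin_num -> (x < +oo)%E by case: x => // r _; exact: ltry.
split.
- apply/integrableP; split.
    by apply/measurable_EFinP/measurable_funTS; exact: measurable_triangle_integrand.
  rewrite (_ : integral _ _ _ = c%:E * J)%E; last first.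
    apply: (etrans _ TJ); apply: eq_integral => p /[!inE] Dp.
    by rewrite /= ger0_norm// triangle_integrand_ge0.
  by apply: lty; apply: fin_numM.
- apply/integrableP; split.
    by apply/measurable_EFinP/measurable_funTS; exact: measurable_square_integrand.
  rewrite (_ : integral _ _ _ = S)%E; last first.
    apply: (etrans _ SqS); apply: eq_integral => p /[!inE] Dp.
    by rewrite /= ger0_norm// square_integrand_ge0.
  exact: lty.
- by rewrite /Rintegral TJ SqS fineM// ratioE -/c mulrA !GammaE.
Qed.

End conclusion.

Theorem theorem1p1 (R : realType) :
  (forall m n : nat, (m <= 2 * n)%N ->
    [/\ (lebesgue_plane R).-integrable (@Delta R)
          (EFin \o @triangle_integrand R m n (2 * m + 1)),
        (lebesgue_plane R).-integrable (@unit_square R)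
          (EFin \o @square_integrand R m n (m + 1)) &
        \int[lebesgue_plane R]_(p in @Delta R)
            triangle_integrand m n (2 * m + 1) p =
        2 ^- (2 * n + 3)
        * (Gamma (n%:R + 2^-1) ^+ 2
           / (Gamma (2 * n%:R - m%:R + 2^-1) * Gamma (m%:R + 2^-1)))
        * \int[lebesgue_plane R]_(p in @unit_square R)
            square_integrand m n (m + 1) p]) /\
  (forall m n : nat, (m <= 2 * n + 1)%N ->
    [/\ (lebesgue_plane R).-integrable (@Delta R)
          (EFin \o @triangle_integrand R m n (2 * m)),
        (lebesgue_plane R).-integrable (@unit_square R)
          (EFin \o @square_integrand R m n m) &
        \int[lebesgue_plane R]_(p in @Delta R)
            triangle_integrand m n (2 * m) p =
        2 ^- (2 * n + 3)
        * (Gamma (n%:R + 2^-1) * Gamma (n%:R + 3 / 2)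
           / (Gamma (2 * n%:R - m%:R + 3 / 2) * Gamma (m%:R + 2^-1)))
        * \int[lebesgue_plane R]_(p in @unit_square R)
            square_integrand m n m p]).

Proof.
split=> m n mn.
- have mn' : (m <= 2 * n + false)%N by rewrite addn0.
  have [int_tri int_sq E] := @triangle_square_identity R m n (2 * m + 1) (m + 1) false
    (addn0 _) (addn0 _) mn'.
  by split; [exact: int_tri|exact: int_sq|rewrite E !addr0 expr2].
- have [int_tri int_sq E] := @triangle_square_identity R m n (2 * m) m true erefl erefl mn.
  have half3 (x : R) : x + 3 / 2 = x + 2^-1 + 1 by field.
  by split; [exact: int_tri|exact: int_sq|rewrite E !half3].
Qed.
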